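(* Let $(X,d)$ be a proper metric space with base point $x_0$. The dimension of the sublinear Higson corona $\nu_L(X)$ of $X$ is the smallest integer $m\ge 0$ with the following property: for every subset $A\subset X$, every norm-preserving asymptotically Lipschitz function $f'\colon A\to \mathbb{R}^{m+1}$ extends to a norm-preserving asymptotically Lipschitz function $g'\colon X\to \mathbb{R}^{m+1}$.
   Context: All metric spaces are equipped with a base point $x_0$; the norm of a point is $|x|=d(x,x_0)$. In $\mathbb{R}^{k}$ the base point is $0$. For points of a subset $A\subset X$, $|x|$ means the norm in $X$. A function $f$ from a subset $A$ of $X$ to $\mathbb{R}^k$ is norm-preserving if $|f(x)|=|x|$ for all $x\in A$. A function $f\colon (X,d_X)\to (Y,d_Y)$ is asymptotically Lipschitz if there are $\lambda, M\ge 0$ with $d_Y(f(x),f(y))\le \lambda\, d_X(x,y)+M$ for all $x,y\in X$ (no continuity required). A metric space is proper if its closed bounded subsets are compact. Let $\mathbb{R}_+=[0,\infty)$. A continuous function $s\colon\mathbb{R}_+\to\mathbb{R}_+$ is asymptotically sublinear if for each non-constant linear function $f\colon\mathbb{R}_+\to\mathbb{R}_+$ there is $M$ such that $s(r)\le f(r)+M$ for all $r$. A continuous function $f\colon (X,d_X)\to (Y,d_Y)$ is Higson sublinear if for each asymptotically sublinear $s$, the conditions $x_n,y_n\to\infty$ (i.e. $|x_n|,|y_n|\to\infty$) and $d_X(x_n,y_n)\le s(|x_n|)$ for all $n\ge 1$ imply $d_Y(f(x_n),f(y_n))\to 0$. The Higson sublinear compactification $h_L(X)$ is the compactification of $X$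 (compact Hausdorff, containing $X$ as a dense subspace) characterized by: a bounded continuous function $X\to\mathbb{R}$ extends continuously over $h_L(X)$ if and only if it is Higson sublinear. For $X$ proper, the sublinear Higson corona is $\nu_L(X)=h_L(X)\setminus X$. Dimension of a compact space means covering dimension. *)

(* Defs.v *)
From HB Require Import structures.
From mathcomp Require Import all_boot all_order all_algebra.
From mathcomp Require Import all_classical all_reals all_analysis.

Set Implicit Arguments.
Unset Strict Implicit.
Unset Printing Implicit Defensive.

Import Order.TTheory GRing.Theory Num.Theory.
Import numFieldNormedType.Exports.

Local Open Scope classical_set_scope.
Local Open Scope ring_scope.

Definition least (P : nat -> Prop) (m : nat) : Prop :=
  P m /\ forall k, P k -> (m <= k)%N.

Section CoveringDimension.
Context (T : topologicalType).
Implicit Types U V : set (set T).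

Definition finite_open_cover U : Prop :=
  [/\ finite_set U, forall A, U A -> open A & \bigcup_(A in U) A = setT].

Definition refines V U : Prop :=
  forall B, V B -> exists2 A, U A & B `<=` A.

(* [n] is a natural number, so the empty space gets dimension 0, not -1; an
   infinite-dimensional space satisfies [covering_dim_le] for no [n]. *)
Definition covering_dim_le (n : nat) : Prop :=
  forall U, finite_open_cover U ->
    exists V, [/\ finite_open_cover V, refines V U &
      forall x : T, ([set B | V B /\ B x] #<= `I_n.+1)%card].

Definition covering_dim (n : nat) : Prop := least covering_dim_le n.

End CoveringDimension.

Section MetricSpaces.
Context (R : realType).

Definition mbounded (X : metricType R) (B : set X) : Prop :=
  exists r : R, forall x y, B x -> B y -> mdist x y <= r.

Definition proper_space (X : metricType R) : Prop :=
  forall B : set X, closed B -> mbounded B -> compact B.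

Definition ptnorm (X : metricType R) (x0 x : X) : R := mdist x x0.

(* The library norm on ['rV[R]_k] is the sup norm. *)
Definition eucl_norm k (v : 'rV[R]_k) : R :=
  Num.sqrt (\sum_(i < k) v 0 i ^+ 2).

(* A function on a subset [A] of [X] is a total function on [X] of which only
   the values on [A] are used. *)
Definition norm_preserving_on (X : metricType R) (x0 : X) k (A : set X)
    (f : X -> 'rV[R]_k) : Prop :=
  forall x, A x -> eucl_norm (f x) = ptnorm x0 x.

Definition asymp_lipschitz_on (X : metricType R) k (A : set X)
    (f : X -> 'rV[R]_k) : Prop :=
  exists lam M : R, [/\ 0 <= lam, 0 <= M &
    forall x y, A x -> A y -> eucl_norm (f x - f y) <= lam * mdist x y + M].

Definition extension_property (X : metricType R) (x0 : X) (m : nat) : Prop :=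
  forall (A : set X) (f : X -> 'rV[R]_m.+1),
    norm_preserving_on x0 A f -> asymp_lipschitz_on A f ->
    exists g : X -> 'rV[R]_m.+1,
      [/\ forall x, A x -> g x = f x,
          norm_preserving_on x0 setT g & asymp_lipschitz_on setT g].

(* Only the values of [s] on [0, +oo) matter. *)
Definition asymp_sublinear (s : R -> R) : Prop :=
  [/\ {within `[0, +oo[%classic, continuous s},
      forall r, 0 <= r -> 0 <= s r &
      forall a, 0 < a -> exists M : R, forall r, 0 <= r -> s r <= a * r + M].

Definition higson_sublinear (X : metricType R) (x0 : X) (Y : metricType R)
    (f : X -> Y) : Prop :=
  continuous f /\
  forall s : R -> R, asymp_sublinear s ->
  forall x y : nat -> X,
    ptnorm x0 (x n) @[n --> \oo] --> +oo ->
    ptnorm x0 (y n) @[n --> \oo] --> +oo ->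
    (forall n, mdist (x n) (y n) <= s (ptnorm x0 (x n))) ->
    mdist (f (x n)) (f (y n)) @[n --> \oo] --> (0 : R).

Definition compactification (X hX : topologicalType) (i : X -> hX) : Prop :=
  [/\ compact [set: hX], hausdorff_space hX, injective i,
      (forall U : set X, open U <-> exists2 V : set hX, open V & i @^-1` V = U)
    & dense (range i)].

Definition higson_sublinear_compactification (X : metricType R) (x0 : X)
    (hX : topologicalType) (i : X -> hX) : Prop :=
  compactification i /\
  forall f : X -> R, continuous f -> bounded_fun f ->
    ((exists2 F : hX -> R, continuous F & forall x, F (i x) = f x) <->
     higson_sublinear x0 (f : X -> R^o)).

End MetricSpaces.

(* [set_type] carries the subspace topology. *)
Definition corona (X hX : topologicalType) (i : X -> hX) : topologicalType :=
  set_type (~` range i).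

(* Main.v *)
Require Import Defs.
From HB Require Import structures.
From mathcomp Require Import all_boot all_order all_algebra.
From mathcomp Require Import all_classical all_reals all_analysis.
From mathcomp Require Import ring lra.

(* Dividing by the norm turns asymptotically Lipschitz functions on X into
   functions that are Higson sublinear up to a bounded error, and conversely
   the functions obtained in this way approximate every Higson sublinear
   function uniformly at infinity (by inf-convolution). So both properties can
   be compared through continuous functions on the corona.

   If the corona has dimension at most m, then an asymptotically Lipschitz
   extension F of f' can be approximated, up to a small multiple of the norm, by
   a map G that factors through the nerve of a fine cover of order m + 1.
   Putting the vertices in general position makes G nonvanishing with a linear
   lower bound; interpolating between F and G and normalizing gives g'.

   Conversely, it suffices to shrink covers of the corona by m + 2 open sets to
   covers with empty intersection. A partition of unity maps the corona to an
   (m+1)-simplex, and the extension property deforms this map off the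
   barycenter, hence into the boundary of the simplex. *)

Set Implicit Arguments.
Unset Strict Implicit.
Unset Printing Implicit Defensive.

Import Order.TTheory GRing.Theory Num.Theory.
Import numFieldNormedType.Exports.

Local Open Scope classical_set_scope.
Local Open Scope ring_scope.

(** * Real-valued asymptotically Lipschitz functions *)

Section AsymptoticallyLipschitz.
Context (R : realType) (X : metricType R).
Implicit Types (E A : set X) (u v : X -> R).

(* Asymptotically Lipschitz on [E], with a single constant playing the role of
   both the slope and the additive constant. *)
Definition al E u : Prop := exists2 C : R, 0 <= C &
  forall x y, E x -> E y -> `|u x - u y| <= C * (mdist x y + 1).

Lemma al_sub E E' u : E `<=` E' -> al E' u -> al E u.
Proof. by move=> EE' [C C0 H]; exists C => // x y /EE' ? /EE' ?; exact: H. Qed.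

Lemma al_cst E (c : R) : al E (fun=> c).
Proof.
exists 0 => // x y _ _; rewrite subrr normr0 mul0r//.
Qed.

Lemma al_close E u v (c : R) :
  (forall x, E x -> `|u x - v x| <= c) -> al E u -> al E v.
Proof.
move=> uv [C C0 H]; exists (C + 2 * `|c|) => [|x y Ex Ey];
  first by rewrite addr_ge0// mulr_ge0.
have := H _ _ Ex Ey; have := uv _ Ex; have := uv _ Ey; have := mdist_ge0 x y.
have := ler_norm c; have := normr_ge0 c.
set d := mdist x y; set c' := `|c|; rewrite !ler_distl =>
  ? ? ? /andP[? ?] /andP[? ?] /andP[? ?].
by apply/andP; split; nra.
Qed.

Lemma al_ext E u v : (forall x, E x -> u x = v x) -> al E u -> al E v.
Proof.
by move=> uv; apply: (@al_close _ _ _ 0) => x Ex; rewrite uv// subrr normr0.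
Qed.

Lemma al_add E u v : al E u -> al E v -> al E (fun x => u x + v x).
Proof.
move=> [C C0 H] [D D0 H']; exists (C + D) => [|x y Ex Ey];
  first by rewrite addr_ge0.
rewrite /= opprD addrACA (le_trans (ler_normD _ _))// mulrDl lerD ?H ?H'//.
Qed.

Lemma al_scale E u (c : R) : al E u -> al E (fun x => c * u x).
Proof.
move=> [C C0 H]; exists (`|c| * C) => [|x y Ex Ey]; first by rewrite mulr_ge0.
by rewrite /= -mulrBr normrM -mulrA ler_wpM2l// H.
Qed.

Lemma al_opp E u : al E u -> al E (fun x => - u x).
Proof.
by move=> /(al_scale (-1)); apply: al_ext => x _; rewrite mulN1r.
Qed.

Lemma al_sub_fun E u v : al E u -> al E v -> al E (fun x => u x - v x).
Proof. by move=> hu hv; apply: al_add => //; apply: al_opp. Qed.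

Lemma al_max E u v : al E u -> al E v -> al E (fun x => Num.max (u x) (v x)).
Proof.
move=> [C C0 H] [D D0 H']; exists (C + D) => [|x y Ex Ey];
  first by rewrite addr_ge0.
have := H _ _ Ex Ey; have := H' _ _ Ex Ey; have := mdist_ge0 x y.
set d := mdist x y; rewrite !ler_distl => ? /andP[? ?] /andP[? ?].
apply/andP; case: (leP (u x) (v x)) => ?; case: (leP (u y) (v y)) => ?; split;
  nra.
Qed.

Lemma al_min E u v : al E u -> al E v -> al E (fun x => Num.min (u x) (v x)).
Proof.
move=> /al_opp hu /al_opp hv; have /al_opp := al_max hu hv.
by apply: al_ext => x _; rewrite -oppr_min opprK.
Qed.

Lemma al_sum E I (r : seq I) (P : pred I) (u : I -> X -> R) :
  (forall i, al E (u i)) -> al E (fun x => \sum_(i <- r | P i) u i x).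
Proof.
move=> H; elim: r => [|i r IH].
  by apply: al_ext (al_cst E 0) => x _; rewrite big_nil.
case Pi : (P i).
  by apply: al_ext (al_add (H i) IH) => x _; rewrite big_cons Pi.
by apply: al_ext IH => x _; rewrite big_cons Pi.
Qed.

(** The difference of two values is a combination of the differences of [a], [b] and [q] whose
    coefficients involve only the ratios [a / q] and [b / q], bounded by [C]. This is what makes
    rescaling a vector-valued map to a prescribed norm harmless. *)
Lemma al_ratio E (a b q : X -> R) (C : R) :
  al E a -> al E b -> al E q ->
  (forall x, E x -> 0 < q x) ->
  (forall x, E x -> `|a x| <= C * q x) ->
  (forall x, E x -> `|b x| <= C * q x) ->
  al E (fun x => b x * a x / q x).
Proof.
move=> [Ca Ca0 Ha] [Cb Cb0 Hb] [Cq Cq0 Hq] q0 aq bq.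
exists (`|C| * Ca + `|C| * (`|C| * Cq + Cb)) => [|x y Ex Ey].
  by rewrite addr_ge0// mulr_ge0// addr_ge0// mulr_ge0.
have qx := q0 _ Ex; have qy := q0 _ Ey.
have -> : b x * a x / q x - b y * a y / q y =
    (b x / q x) * (a x - a y) +
    (a y / q y) * ((b x / q x) * (q y - q x) + (b x - b y)).
  by field; rewrite !gt_eqF.
have bC : `|b x / q x| <= `|C|.
  rewrite normrM normfV (gtr0_norm qx) ler_pdivrMr// (le_trans (bq _ Ex))//.
  by rewrite ler_wpM2r ?ler_norm// ltW.
have aC : `|a y / q y| <= `|C|.
  rewrite normrM normfV (gtr0_norm qy) ler_pdivrMr// (le_trans (aq _ Ey))//.
  by rewrite ler_wpM2r ?ler_norm// ltW.
have D0 : 0 <= mdist x y + 1 by rewrite addr_ge0// mdist_ge0.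
rewrite (le_trans (ler_normD _ _))// mulrDl lerD//.
  by rewrite normrM -[X in _ <= X]mulrA; apply: ler_pM => //; rewrite Ha.
rewrite normrM -[X in _ <= X]mulrA; apply: ler_pM => //.
rewrite (le_trans (ler_normD _ _))// mulrDl lerD ?Hb//.
by rewrite normrM -[X in _ <= X]mulrA; apply: ler_pM => //; rewrite distrC Hq.
Qed.

(** [e] is the inf-convolution of [phi] with [K] times the metric. As an infimum of [K]-Lipschitz
    functions it is [K]-Lipschitz; the last two clauses characterize it as the greatest lower
    bound. *)
Lemma envelope A (phi : X -> R) (K : R) : A !=set0 -> 0 <= K ->
  (forall x, exists l, forall a, A a -> l <= phi a + K * mdist x a) ->
  exists e : X -> R, [/\
    forall x y, `|e x - e y| <= K * mdist x y,
    forall x a, A a -> e x <= phi a + K * mdist x a &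
    forall x l, (forall a, A a -> l <= phi a + K * mdist x a) -> l <= e x].
Proof.
move=> [a0 Aa0] K0 lb.
pose S x := [set phi a + K * mdist x a | a in A].
have S0 x : S x !=set0 by exists (phi a0 + K * mdist x a0), a0.
have Slb x : has_lbound (S x).
  by have [l hl] := lb x; exists l => _ [a Aa <-]; exact: hl.
have le1 x a : A a -> inf (S x) <= phi a + K * mdist x a.
  by move=> Aa; apply: ge_inf => //; exists a.
have ge1 x l : (forall a, A a -> l <= phi a + K * mdist x a) -> l <= inf (S x).
  by move=> h; apply: lb_le_inf => // _ [a Aa <-]; exact: h.
exists (fun x => inf (S x)); split => //.
suff H x y : inf (S x) - K * mdist x y <= inf (S y).
  move=> x y; have := H x y; have := H y x; rewrite (metric_sym y x) => h1 h2.
  by rewrite ler_distl; apply/andP; split; lra.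
apply: ge1 => a Aa; have := le1 x _ Aa; have := metric_triangle x y a.
by move: K0; set p := mdist x a; set q := mdist x y; set r := mdist y a; nra.
Qed.

(** McShane extension: the envelope of [u] with slope [C] is Lipschitz on all of [X], and the
    additive constant in the estimate for [u] costs only a bounded error on [A]. *)
Lemma al_smoothing A u : al A u -> exists (v : X -> R) (K M : R),
  [/\ 0 <= K, forall x y, `|v x - v y| <= K * mdist x y &
      forall x, A x -> `|u x - v x| <= M].
Proof.
move=> [C C0 H]; have [->|/set0P[a Aa]] := eqVneq A set0.
  by exists (fun=> 0), 0, 0; split => // x y; rewrite subrr normr0 mul0r.
have H1 b c : A b -> A c -> u b - C <= u c + C * mdist b c.
  by move=> Ab Ac; have := H _ _ Ab Ac; rewrite ler_distl mulrDr mulr1 =>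
    /andP[_ ?]; lra.
have [||e [e1 e2 e3]] := @envelope A u C _ C0.
- by exists a.
- move=> x; exists (u a - C - C * mdist x a) => b Ab.
  have := H1 _ _ Aa Ab; have := metric_triangle a x b; rewrite (metric_sym a x).
  by move: C0; set p := mdist x a; set q := mdist x b; set r := mdist a b; nra.
exists e, C, C; split => // x Ax; rewrite ler_distl; apply/andP; split.
  by have := e2 x x Ax; rewrite mdistxx; lra.
suff : u x - C <= e x by lra.
by apply: e3 => b Ab; exact: H1.
Qed.

Lemma lip_al E u (K : R) : 0 <= K ->
  (forall x y, `|u x - u y| <= K * mdist x y) -> al E u.
Proof.
move=> K0 H; exists K => // x y _ _; rewrite (le_trans (H _ _))//.
by rewrite ler_wpM2l// lerDl.
Qed.

End AsymptoticallyLipschitz.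

(** * The Euclidean norm and its comparison with coordinates *)

Section EuclideanNorm.
Context (R : realType) (k : nat).
Implicit Types u v : 'rV[R]_k.

Lemma eucl_norm_ge0 v : 0 <= eucl_norm v.
Proof. exact: sqrtr_ge0. Qed.

Lemma eucl_norm_sqr v : eucl_norm v ^+ 2 = \sum_(j < k) v 0 j ^+ 2.
Proof. by rewrite sqr_sqrtr// sumr_ge0// => j _; rewrite sqr_ge0. Qed.

Lemma coord_le_eucl_norm v j : `|v 0 j| <= eucl_norm v.
Proof.
rewrite -sqrtr_sqr ler_wsqrtr// (bigD1 j)//= lerDl sumr_ge0// => i _.
exact: sqr_ge0.
Qed.

Lemma eucl_norm0 : eucl_norm (0 : 'rV[R]_k) = 0.
Proof.
by rewrite /eucl_norm big1 ?sqrtr0// => j _; rewrite mxE expr0n.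
Qed.

Lemma eucl_normZ (c : R) v : eucl_norm (c *: v) = `|c| * eucl_norm v.
Proof.
rewrite /eucl_norm -sqrtr_sqr -sqrtrM ?sqr_ge0// mulr_sumr.
by congr Num.sqrt; apply: eq_bigr => j _; rewrite mxE exprMn.
Qed.

(* Both norms are compared through the difference of their squares, which
   avoids Cauchy-Schwarz. *)
Lemma eucl_norm_dist u v :
  `|eucl_norm u - eucl_norm v| <= \sum_(j < k) `|u 0 j - v 0 j|.
Proof.
have [s0|s0] := eqVneq (eucl_norm u + eucl_norm v) 0.
  have : eucl_norm u - eucl_norm v = 0.
    by move: s0 (eucl_norm_ge0 u) (eucl_norm_ge0 v); lra.
  by move=> ->; rewrite normr0 sumr_ge0.
have {}s0 : 0 < eucl_norm u + eucl_norm v.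
  by rewrite lt_neqAle eq_sym s0 addr_ge0 ?eucl_norm_ge0.
rewrite -(ler_pM2r s0) -[X in _ * X](gtr0_norm s0) -normrM -subr_sqr.
rewrite !eucl_norm_sqr -sumrB mulr_suml (le_trans (ler_norm_sum _ _ _))//.
apply: ler_sum => j _; rewrite subr_sqr normrM ler_wpM2l//.
rewrite (le_trans (ler_normD _ _))// lerD//;
  exact: coord_le_eucl_norm.
Qed.

Lemma eucl_norm_le_sum v : eucl_norm v <= \sum_(j < k) `|v 0 j|.
Proof.
have := eucl_norm_dist v 0; rewrite eucl_norm0 subr0 ger0_norm ?eucl_norm_ge0//.
by under eq_bigr do rewrite mxE subr0.
Qed.

Lemma eucl_norm_le v (c : R) :
  (forall j, `|v 0 j| <= c) -> eucl_norm v <= k%:R * c.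
Proof.
move=> vc; rewrite (le_trans (eucl_norm_le_sum v))//.
rewrite (le_trans (ler_sum _ (fun j _ => vc j)))//.
by rewrite sumr_const card_ord mulr_natl.
Qed.

Lemma eucl_norm_dist_le u v (c : R) :
  (forall j, `|u 0 j - v 0 j| <= c) -> `|eucl_norm u - eucl_norm v| <= k%:R * c.
Proof.
move=> vc; rewrite (le_trans (eucl_norm_dist u v))//.
rewrite (le_trans (ler_sum _ (fun j _ => vc j)))//.
by rewrite sumr_const card_ord mulr_natl.
Qed.

End EuclideanNorm.

Section AsymptoticallyLipschitzVector.
Context (R : realType) (X : metricType R) (k : nat).
Implicit Types (E : set X) (f : X -> 'rV[R]_k).


Lemma al_eucl_norm E f :
  (forall j, al E (fun x => f x 0 j)) -> al E (fun x => eucl_norm (f x)).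
Proof.
move=> fal; have /choice[C HC] : forall j, exists C : R, 0 <= C /\
    forall x y, E x -> E y -> `|f x 0 j - f y 0 j| <= C * (mdist x y + 1).
  by move=> j; have [C C0 H] := fal j; exists C.
exists (\sum_(j < k) C j) => [|x y Ex Ey].
  by rewrite sumr_ge0// => j _; have [] := HC j.
rewrite (le_trans (eucl_norm_dist _ _))// mulr_suml ler_sum// => j _.
by have [_ ->] := HC j.
Qed.

Lemma asymp_lipschitz_onP E f :
  asymp_lipschitz_on E f <-> forall j, al E (fun x => f x 0 j).
Proof.
split=> [[lam [M [lam0 M0 H]]] j|H].
  exists (lam + M) => [|x y Ex Ey]; first exact: addr_ge0.
  have := coord_le_eucl_norm (f x - f y) j; rewrite !mxE => /le_trans; apply.
  rewrite (le_trans (H _ _ Ex Ey))//.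
  by have := mdist_ge0 x y; nra.
have /choice[C HC] : forall j, exists C : R, 0 <= C /\
    forall x y, E x -> E y -> `|f x 0 j - f y 0 j| <= C * (mdist x y + 1).
  by move=> j; have [C C0 h] := H j; exists C.
exists (\sum_(j < k) C j), (\sum_(j < k) C j).
have S0 : 0 <= \sum_(j < k) C j by rewrite sumr_ge0// => j _; have [] := HC j.
split => // x y Ex Ey.
set S := \sum_(j < k) C j; have -> :
  S * mdist x y + S = S * (mdist x y + 1) by ring.
rewrite (le_trans (eucl_norm_le_sum _))// mulr_suml ler_sum// => j _.
by rewrite !mxE; have [_ ->] := HC j.
Qed.

End AsymptoticallyLipschitzVector.

Lemma lip_continuous (R : realType) (X : metricType R) (u : X -> R) (K : R) :
  (forall x y, `|u x - u y| <= K * mdist x y) -> continuous u.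
Proof.
move=> H x; apply/cvgrPdist_le => e e0.
have K0 : 0 < `|K| + 1 by rewrite ltr_wpDl.
near=> y; rewrite (le_trans (H _ _))//.
rewrite (@le_trans _ _ ((`|K| + 1) * mdist x y))//.
  by rewrite ler_wpM2r ?mdist_ge0// (le_trans (ler_norm _))// lerDl.
rewrite mulrC -ler_pdivlMr// ltW//.
have : ball x (e / (`|K| + 1)) y by near: y; apply: nbhsx_ballx;
  rewrite divr_gt0.
by rewrite ballEmdist.
Unshelve. all: by end_near. Qed.

(** * The norm of a point and neighbourhoods of infinity *)

Section Norm.
Context (R : realType) (X : metricType R) (x0 : X).

Lemma ptnorm_ge0 x : 0 <= ptnorm x0 x.
Proof. exact: mdist_ge0. Qed.

Lemma ptnorm_lip x y : `|ptnorm x0 x - ptnorm x0 y| <= 1 * mdist x y.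
Proof.
rewrite /ptnorm mul1r ler_distl; have := metric_triangle x y x0.
have := metric_triangle y x x0; rewrite (metric_sym y x) => ? ?.
by apply/andP; split; lra.
Qed.

Lemma ptnorm_triangle x y : ptnorm x0 x <= ptnorm x0 y + mdist x y.
Proof. by rewrite addrC; exact: metric_triangle. Qed.

(** The cutoff at 1 allows division near the base point and keeps the function 1-Lipschitz. *)
Definition wt (x : X) : R := Num.max 1 (ptnorm x0 x).

Lemma wt_ge1 x : 1 <= wt x. Proof. by rewrite le_max lexx. Qed.

Lemma wt_gt0 x : 0 < wt x. Proof. exact: lt_le_trans (wt_ge1 x). Qed.

Lemma ptnorm_le_wt x : ptnorm x0 x <= wt x.
Proof. by rewrite le_max lexx orbT. Qed.

Lemma wt_le x (c : R) : 1 <= c -> ptnorm x0 x <= c -> wt x <= c.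
Proof. by move=> ? ?; rewrite ge_max; apply/andP. Qed.

Lemma wt_ptnorm x : 1 <= ptnorm x0 x -> wt x = ptnorm x0 x.
Proof. by move/max_idPr. Qed.

Lemma wt_lip x y : `|wt x - wt y| <= 1 * mdist x y.
Proof.
have := ptnorm_lip x y; rewrite mul1r !ler_distl /wt; have := mdist_ge0 x y.
set d := mdist x y => d0 /andP[? ?].
by apply/andP; case: (leP 1 (ptnorm x0 x)) => ?;
  case: (leP 1 (ptnorm x0 y)) => ?; split; lra.
Qed.

Lemma al_ptnorm (E : set X) : al E (ptnorm x0).
Proof. exact: lip_al ler01 ptnorm_lip. Qed.

Lemma al_wt (E : set X) : al E wt.
Proof. exact: lip_al ler01 wt_lip. Qed.

(** The filter of neighbourhoods of infinity. It is improper when [X] is bounded, so only a [Filter]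
    instance is declared. *)
Definition far : set_system X :=
  [set P | exists r : R, forall x, r < ptnorm x0 x -> P x].

#[global] Instance far_filter : Filter far.
Proof.
split.
- by exists 0.
- move=> P Q [r Pr] [s Qs]; exists (Num.max r s) => x.
  by rewrite gt_max => /andP[? ?]; split; [exact: Pr|exact: Qs].
- by move=> P Q PQ [r Pr]; exists r => x /Pr; exact: PQ.
Qed.

Lemma far_gt (r : R) : \forall x \near far, r < ptnorm x0 x.
Proof. by exists r. Qed.

Lemma far_ge_wt (r : R) : \forall x \near far, r <= wt x.
Proof. by exists r => x /ltW /le_trans; apply; exact: ptnorm_le_wt. Qed.

Lemma far_wt : \forall x \near far, wt x = ptnorm x0 x.
Proof. by exists 1 => x /ltW /wt_ptnorm. Qed.

(** Points outside [E] have bounded norm, so there [u] is bounded, and its growth bound controls the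
    difference to any other value by a multiple of the distance plus a constant. Estimates may thus
    be restricted to points far out. *)
Lemma al_far (E : set X) (u : X -> R) (C : R) :
  far E -> al E u -> (forall x, `|u x| <= C * wt x) -> al setT u.
Proof.
move=> [r Er] [K K0 H] uC.
pose B := Num.max 1 r; have B1 : 1 <= B by rewrite le_max lexx.
have C0 : 0 <= C.
  by have := le_trans (normr_ge0 _) (uC x0); rewrite pmulr_lge0// wt_gt0.
have bad x y : ~ E x -> `|u x - u y| <= (K + C + 2 * C * B) * (mdist x y + 1).
  move=> nEx; have wB : wt x <= B.
    apply: wt_le => //; rewrite le_max; apply/orP; right.
    by rewrite leNgt; apply/negP => /Er.
  rewrite (le_trans (ler_normB _ _))//.
  have := uC x; have := uC y; have := wt_lip x y; have := mdist_ge0 x y.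
  rewrite ler_distl; set d := mdist x y; move=> d0 /andP[w1 w2] uy ux.
  have : C * wt y <= C * (B + d) by rewrite ler_wpM2l//; lra.
  have : C * wt x <= C * B by rewrite ler_wpM2l//.
  have : 0 <= K * d by rewrite mulr_ge0.
  have : 0 <= C * B * d by rewrite !mulr_ge0// (le_trans ler01).
  by move: B1 uy ux K0 C0 w1 w2 => *; lra.
have [CB0 CB1] : 0 <= C /\ 0 <= 2 * C * B.
  by split => //; rewrite !mulr_ge0// (le_trans ler01).
exists (K + C + 2 * C * B) => [|x y _ _]; first by rewrite !addr_ge0.
have [Ex|/bad//] := pselect (E x).
have [Ey|/bad] := pselect (E y); last by rewrite distrC metric_sym; exact.
rewrite (le_trans (H _ _ Ex Ey))// ler_wpM2r ?addr_ge0 ?mdist_ge0//.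
by rewrite -addrA lerDl addr_ge0.
Qed.

End Norm.

(** * Neighbourhoods of the corona and points far out in the space *)

Section Compactification.
Context (R : realType) (X : metricType R) (x0 : X) (hX : topologicalType).
Context (i : X -> hX).
Hypothesis ci : compactification i.

Let cpt : compact [set: hX]. Proof. by case: ci. Qed.
Let hsd : hausdorff_space hX. Proof. by case: ci. Qed.
Let opi : forall U : set X, open U <-> exists2 V : set hX,
  open V & i @^-1` V = U.
Proof. by case: ci. Qed.
Let dns : dense (range i). Proof. by case: ci. Qed.

Lemma compactification_continuous : continuous i.
Proof. by apply/continuousP => V oV; apply/opi; exists V. Qed.

(* A property holding near every point of the corona holds far out in [X]: the
   remaining points of [hX] are images of points with norms locally bounded. *)
Lemma near_corona_far (P : set hX) :
  (forall z, ~ range i z -> \forall z' \near z, P z') ->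
  \forall x \near far x0, P (i x).
Proof.
move=> nP.
(* The radius is the parameter of the near-covering: compactness makes one radius work for all
   points of [hX] at once. *)
have /compact_near_coveringP/(_ R (pinfty_nbhs R)
   (fun r z => forall x, i x = z -> r < ptnorm x0 x -> P z) _) := cpt.
case=> [z _|r [rr H]].
  have [[x _ <-]|/nP nz] := pselect (range i z); last first.
    near=> z' r; have Pz : P z' by near: z'.
    by move=> x _ _.
  have [V oV Vx] := (opi (ball x 1)°).1 (@open_interior _ _).
  near=> z' r.
  have Vz : V z'.
    near: z'; apply: open_nbhs_nbhs; split => //.
    by have : (i @^-1` V) x by rewrite Vx; exact: nbhsx_ballx.
  have xr : ptnorm x0 x + 1 < r by near: r; apply: nbhs_pinfty_gt;
    rewrite num_real.
  move=> y iy ry; exfalso; have : (i @^-1` V) y by rewrite /preimage /= iy.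
  rewrite Vx => /interior_subset; rewrite ballEmdist /= => xy.
  have := ptnorm_triangle x0 y x; rewrite metric_sym => h1.
  by have := lt_trans xr ry; rewrite /= ltNge (le_trans h1)// lerD2l ltW.
have [r' [rr' r'H]] : exists r', r < r' /\ True by exists (r + 1); split => //;
  rewrite ltrDl.
exists r' => x rx; apply: (H r' rr' (i x)) => //.
Unshelve. all: by end_near. Qed.

(** By properness the ball outside of which [Q] holds is compact, so its image is closed and misses
    [z]. Density then gives a point of [X] in the rest of the neighbourhood. *)
Lemma far_near_corona (z : hX) (O : set hX) (Q : set X) :
  ~ range i z -> nbhs z O -> far x0 Q -> proper_space X ->
  exists2 x, Q x & O (i x).
Proof.
move=> nz Oz [r rQ] prX.
pose B := [set x | ptnorm x0 x <= r].
have cB : compact B.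
  apply: prX.
    have -> : B = ptnorm x0 @^-1` [set t | t <= r] by [].
    apply: closed_comp; last exact: closed_le.
    by move=> x _; apply: lip_continuous (ptnorm_lip x0) x.
  exists (r + r) => x y; rewrite /B /= => xr yr.
  by have := metric_triangle x x0 y;
    rewrite (metric_sym x0 y) /ptnorm in xr yr *; lra.
have ciB : closed (i @` B).
  apply: compact_closed => //; apply: continuous_compact => //.
  exact/continuous_subspaceT/compactification_continuous.
move: Oz; rewrite nbhsE => -[U [oU Uz] UO].
have [|y [[Ux nBx] [x _ xE]]] := dns (O :=
  U `&` ~` (i @` B)) _ (openI oU (closed_openC ciB)).
  by exists z; split => // -[x _ xz]; apply: nz; exists x.
rewrite -xE in Ux nBx; exists x; last exact: UO.
by apply: rQ; rewrite ltNge; apply/negP => xr; apply: nBx; exists x.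
Qed.

End Compactification.

(** * Higson sublinearity as an oscillation condition *)

Section HigsonSublinear.
Context (R : realType) (X : metricType R) (x0 : X).

(* The sublinear function [s] is the largest one below all the affine functions
   [r / (k + 2) + C k]. *)
Lemma asymp_sublinear_majorant (rho d : nat -> R) :
  (forall n, 0 <= d n) -> (forall n, 0 <= rho n) ->
  (forall n, d n <= rho n / n.+2%:R) ->
  exists2 s, asymp_sublinear s & forall n, d n <= s (rho n).
Proof.
move=> d0 rho0 drho.
pose C k := \sum_(n < k) d n.
have C0 k : 0 <= C k by rewrite sumr_ge0.
pose S (r : R) := [set `|r| / k.+2%:R + C k | k in [set: nat]].
have S0 r : S r !=set0 by exists (`|r| / 2 + C 0%N), 0%N.
have Sge0 r : lbound (S r) 0.
  by move=> _ [k _ <-]; rewrite addr_ge0// divr_ge0.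
have le1 r k : inf (S r) <= `|r| / k.+2%:R + C k.
  by apply: ge_inf; [exists 0; exact: Sge0|exists k].
have ge1 r l : (forall k, l <= `|r| / k.+2%:R + C k) -> l <= inf (S r).
  by move=> h; apply: lb_le_inf => // _ [k _ <-]; exact: h.
exists (inf \o S); last first.
  move=> n; apply: ge1 => k; rewrite ger0_norm//.
  (* For [n < k] the constant [C k] contains [d n]; otherwise the slope [1 / (k + 2)] is at least
     [1 / (n + 2)]. *)
  have [nk|kn] := ltnP n k.
    rewrite (@le_trans _ _ (C k))// ?lerDr ?divr_ge0//.
    by rewrite /C (bigD1 (Ordinal nk))//= lerDl sumr_ge0.
  rewrite (@le_trans _ _ (rho n / k.+2%:R))// ?lerDl// (le_trans (drho n))//.
  by rewrite ler_wpM2l// lef_pV2 ?posrE// ler_nat.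
have H r t : inf (S r) - `|r - t| <= inf (S t).
  apply: ge1 => k; have := le1 r k; have : `|r| <= `|t| + `|r - t|.
    by rewrite (le_trans _ (ler_normD _ _))// addrC subrK.
  have k0 : 0 < (k.+2%:R : R)^-1 by rewrite invr_gt0.
  have k1 : (k.+2%:R : R)^-1 <= 1 by rewrite invf_le1// ler1n.
  move=> /(ler_wpM2r (ltW k0)); have := ler_wpM2l (normr_ge0 (r - t)) k1.
  by move: (_^-1) (inf (S r)) `|r| `|t| `|r - t| => c m a b e; lra.
split.
- apply: continuous_subspaceT; apply: (@lip_continuous R R^o (inf \o S) 1).
  move=> r t; rewrite mul1r [mdist _ _]distrC /= ler_distl.
  by have := H r t; have := H t r; rewrite (distrC t r) => ? ?; apply/andP;
    split; lra.
- by move=> r _; exact: lb_le_inf.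
- move=> a a0; have [k ka] : exists k : nat, a^-1 < k%:R.
    by exists (Num.truncn a^-1).+1; rewrite truncnS_gt.
  exists (C k) => r r0; rewrite (le_trans (le1 r k))// ger0_norm// lerD2r.
  rewrite mulrC ler_wpM2r//.
  rewrite -[leRHS]invrK lef_pV2 ?posrE ?invr_gt0//.
  by rewrite (le_trans (ltW ka))// ler_nat -addn2 leq_addr.
Qed.

(** If [del = 1 / (n + 2)] and [r = n] fail for every [n], the counterexamples form two sequences
    whose distances are dominated by an asymptotically sublinear function, while the values of [h]
    stay [eps] apart. *)
Lemma higson_sublinear_osc (h : X -> R) :
  higson_sublinear x0 (h : X -> R^o) -> forall eps, 0 < eps ->
  exists del r : R, 0 < del /\ forall x y, r <= ptnorm x0 x ->
    mdist x y <= del * ptnorm x0 x -> `|h x - h y| <= eps.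
Proof.
move=> [_ H] eps eps0; apply: contrapT => nH.
have /choice[xy Hxy] : forall n : nat, exists xy : X * X,
    [/\ n%:R <= ptnorm x0 xy.1, mdist xy.1 xy.2 <= ptnorm x0 xy.1 / n.+2%:R
      & eps < `|h xy.1 - h xy.2|].
  move=> n; apply: contrapT => nxy; apply: nH.
  exists n.+2%:R^-1, n%:R; split => [|x y nx dxy]; first by rewrite invr_gt0.
  rewrite leNgt; apply/negP => exy; apply: nxy; exists (x, y); split => //=.
  by rewrite mulrC.
have [s ss ds] := @asymp_sublinear_majorant (fun n => ptnorm x0 (xy n).1)
  (fun n => mdist (xy n).1 (xy n).2) (fun n => mdist_ge0 _ _)
  (fun n => ptnorm_ge0 _ _) (fun n => let: And3 _ p _ := Hxy n in p).
have xoo : ptnorm x0 (xy n).1 @[n --> \oo] --> +oo.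
  apply/cvgryPge => A; near=> n; have [nx _ _] := Hxy n.
  by rewrite (le_trans _ nx)//; near: n; exact: nbhs_infty_ger.
have yoo : ptnorm x0 (xy n).2 @[n --> \oo] --> +oo.
  apply/cvgryPge => A; near=> n; have [nx dn _] := Hxy n.
  have := ptnorm_triangle x0 (xy n).1 (xy n).2.
  (* The denominators are at least 2, so the second point keeps at least half the norm of the first
     and also tends to infinity. *)
  have : mdist (xy n).1 (xy n).2 <= ptnorm x0 (xy n).1 / 2.
    rewrite (le_trans dn)//.
    by rewrite ler_wpM2l ?ptnorm_ge0// lef_pV2 ?posrE// ler_nat.
  have : A + A <= n%:R by near: n; exact: nbhs_infty_ger.
  by move: nx; clear; lra.
have /cvgrPdist_lt/(_ eps eps0)[N _ /(_ N (leqnn _))] := H s ss _ _ xoo yoo ds.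
rewrite /= sub0r normrN normr_id => /lt_trans.
have [_ _ h1] := Hxy N; move=> /(_ _ h1).
by rewrite distrC ltxx.
Unshelve. all: by end_near. Qed.

Lemma osc_higson_sublinear (h : X -> R) : continuous h ->
  (forall eps, 0 < eps -> exists del r : R, 0 < del /\
    forall x y, r <= ptnorm x0 x ->
      mdist x y <= del * ptnorm x0 x -> `|h x - h y| <= eps) ->
  higson_sublinear x0 (h : X -> R^o).
Proof.
move=> ch H; split => // s [_ _ ss] x y /cvgryPge xoo _ dxy.
apply/cvgrPdist_le => e e0; have [del [r [del0 rH]]] := H e e0.
(* Half of [del] is spent on the slope; the other half absorbs [M] once the norm is large. *)
have [M sM] : exists M, forall r, 0 <= r -> s r <= del / 2 * r + M.
  by apply: ss; rewrite divr_gt0.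
near=> n; rewrite sub0r normrN [mdist _ _]distrC normr_id.
apply: rH; first by near: n; exact: xoo.
rewrite (le_trans (dxy n))// (le_trans (sM _ (ptnorm_ge0 _ _)))//.
suff : M / (del / 2) <= ptnorm x0 (x n).
  by rewrite ler_pdivrMr ?divr_gt0//; lra.
by near: n; exact: xoo.
Unshelve. all: by end_near. Qed.

End HigsonSublinear.

(** * Asymptotically Lipschitz functions versus continuous functions on the compactification *)

Section HigsonCompactification.
Context (R : realType) (X : metricType R) (x0 : X) (hX : topologicalType).
Context (i : X -> hX).
Hypothesis hi : higson_sublinear_compactification x0 i.

Lemma bounded_fun_le (f : X -> R) (B : R) :
  (forall x, `|f x| <= B) -> bounded_fun f.
Proof.
move=> fB; exists B; split => [|M BM x _]; first exact: num_real.
by rewrite /= (le_trans (fB x))// ltW.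
Qed.

(** After smoothing, [v / wt] varies by at most a multiple of the distance divided by [wt x], hence
    little on balls of radius a small multiple of the norm. It is therefore Higson sublinear and
    extends. *)
Lemma al_extends (E : set X) (u : X -> R) : al E u ->
  exists (F : hX -> R) (C : R), continuous F /\
    forall x, E x -> `|u x - wt x0 x * F (i x)| <= C.
Proof.
move=> /al_smoothing[v [K [M [K0 vK vM]]]].
pose B := `|v x0| + K; have B0 : 0 <= B by rewrite addr_ge0.
have vB x : `|v x| <= B * wt x0 x.
  have := vK x x0; have := ptnorm_le_wt x0 x; have := wt_ge1 x0 x.
  have : `|v x| <= `|v x0| + `|v x - v x0|.
    by rewrite (le_trans _ (ler_normD _ _))// addrC subrK.
  rewrite /B /ptnorm; move: (`|v x - v x0|) (`|v x0|) (normr_ge0 (v x0)) =>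
    a b b0.
  move: K0; move: (mdist x x0) (wt x0 x) `|v x| => d w z; nra.
pose h x := v x / wt x0 x.
have h_lip x y : `|h x - h y| <= (K + B) * mdist x y / wt x0 x.
  have w0 := wt_gt0 x0 x; have w1 := wt_gt0 x0 y.
  have -> : h x - h y =
      ((v x - v y) + v y / wt x0 y * (wt x0 y - wt x0 x)) / wt x0 x.
    by rewrite /h; field; rewrite !gt_eqF.
  rewrite normrM normfV (gtr0_norm w0); apply: ler_wpM2r;
    first by rewrite invr_ge0 ltW.
  rewrite (le_trans (ler_normD _ _))// mulrDl lerD// normrM; apply: ler_pM =>
    //.
    by rewrite normrM normfV (gtr0_norm w1) ler_pdivrMr.
  by rewrite distrC -[leRHS]mul1r; exact: wt_lip.
have ch : continuous h.
  apply: (@lip_continuous _ _ _ (K + B)) => x y;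
    rewrite (le_trans (h_lip x y))//.
  rewrite ler_pdivrMr ?wt_gt0// ler_peMr ?wt_ge1// mulr_ge0 ?addr_ge0//.
  exact: mdist_ge0.
have bh : bounded_fun h.
  apply: (@bounded_fun_le _ B) => x.
  by rewrite normrM normfV (gtr0_norm (wt_gt0 _ _)) ler_pdivrMr ?wt_gt0.
have [F cF Fh] : exists2 F : hX -> R, continuous F & forall x, F (i x) = h x.
  apply/(hi.2 h ch bh); apply: osc_higson_sublinear => // e e0.
  have KB0 : 0 < K + B + 1 by rewrite ltr_wpDl// addr_ge0.
  exists (e / (K + B + 1)), 1; split => [|x y x1 dxy];
    first by rewrite divr_gt0.
  rewrite (le_trans (h_lip x y))// ler_pdivrMr ?wt_gt0// wt_ptnorm//.
  rewrite (@le_trans _ _ ((K + B + 1) * mdist x y))//.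
    by rewrite ler_wpM2r ?mdist_ge0// lerDl.
  by move: dxy; rewrite mulrAC ler_pdivlMr// mulrC.
exists F, M; split => // x Ex.
by rewrite Fh /h mulrCA divff ?gt_eqF ?wt_gt0// mulr1 vM.
Qed.

(** A converse to [al_extends] up to [eps * wt]: [u] is the inf-convolution of [wt * f] with a slope
    chosen from the oscillation of [f]. *)
Lemma al_approx (F : hX -> R) (eps : R) : continuous F ->
  (forall z, 0 <= F z <= 1) -> 0 < eps ->
  exists (u : X -> R) (C : R), al setT u /\
    forall x, `|u x - wt x0 x * F (i x)| <= eps * wt x0 x + C.
Proof.
move=> cF F01 eps0; pose f := F \o i.
have f01 x : 0 <= f x <= 1 by exact: F01.
have cf : continuous f.
  by move=> x; apply: continuous_comp; [exact:
    (compactification_continuous hi.1)|exact: cF].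
have bf : bounded_fun f.
  apply: (@bounded_fun_le _ 1) => x.
  by rewrite ger0_norm; case/andP: (f01 x).
have hf : higson_sublinear x0 (f : X -> R^o) by apply/(hi.2 f cf bf); exists F.
have [del [r [del0 H]]] := higson_sublinear_osc hf eps0.
(* The summand 1 pays for the variation of [wt] between nearby points; [del^-1] makes the penalty
   exceed the norm of [x] at distances beyond [del] times that norm. *)
pose K := 1 + del^-1.
have K0 : 0 <= K by rewrite addr_ge0// invr_ge0 ltW.
have wf0 x : 0 <= wt x0 x * f x.
  by rewrite mulr_ge0//; [exact/ltW/wt_gt0|case/andP: (f01 x)].
have := @envelope _ _ setT (fun x => wt x0 x * f x) K; case.
- by exists x0.
- exact: K0.
- by move=> x; exists 0 => y _; rewrite addr_ge0// mulr_ge0// mdist_ge0.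
move=> u [u1 u2 u3]; pose B := Num.max 1 r.
have B1 : 1 <= B by rewrite le_max lexx.
exists u, B; split; first exact: lip_al u1.
move=> x; have ux : u x <= wt x0 x * f x by have := u2 x x I;
  rewrite mdistxx mulr0 addr0.
have u0 : 0 <= u x.
  by apply: u3 => y _; rewrite addr_ge0// mulr_ge0// mdist_ge0.
rewrite distrC ger0_norm ?subr_ge0//.
have [xB|Bx] := leP (ptnorm x0 x) B.
  have wB : wt x0 x <= B by exact: wt_le.
  have /andP[_ f1] := f01 x.
  have : 0 <= eps * wt x0 x by rewrite mulr_ge0// ltW// wt_gt0.
  have : wt x0 x * f x <= wt x0 x by rewrite ler_piMr// ltW// wt_gt0.
  by rewrite /f /=; lra.
suff : wt x0 x * f x - eps * wt x0 x <= u x by rewrite /f /=; lra.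
apply: u3 => y _.
have wx : wt x0 x = ptnorm x0 x by apply: wt_ptnorm; rewrite (le_trans B1)//
  ltW.
have d0 := mdist_ge0 x y; have /andP[f0 f1] := f01 x.
have [dx|dx] := leP (mdist x y) (del * ptnorm x0 x).
  have := H x y _ dx; rewrite (le_trans _ (ltW Bx)) ?le_max ?lexx ?orbT//.
  move=> /(_ isT); rewrite ler_distl => /andP[_ fy].
  have Kd : mdist x y <= K * mdist x y.
    by rewrite ler_peMl// lerDl invr_ge0 ltW.
  have [fe|fe] := leP (f x) eps.
    have : wt x0 x * f x <= wt x0 x * eps by rewrite ler_wpM2l// ltW// wt_gt0.
    have := wf0 y; lra.
  have : wt x0 y * (f x - eps) <= wt x0 y * f y.
    by rewrite ler_wpM2l ?(ltW (wt_gt0 _ _))//; lra.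
  have : (wt x0 x - wt x0 y) * (f x - eps) <= mdist x y * (f x - eps).
    rewrite ler_wpM2r//; first by lra.
    by rewrite (le_trans (ler_norm _))// -[leRHS]mul1r; exact: wt_lip.
  have : mdist x y * (f x - eps) <= mdist x y by rewrite ler_piMr//; lra.
  lra.
have : ptnorm x0 x <= K * mdist x y.
  rewrite (@le_trans _ _ (del^-1 * mdist x y))//.
    by rewrite mulrC ler_pdivlMr// mulrC ltW.
  by rewrite ler_wpM2r// lerDr.
have : wt x0 x * f x <= wt x0 x by rewrite ler_piMr// ltW// wt_gt0.
have : 0 <= eps * wt x0 x by rewrite mulr_ge0// ltW// wt_gt0.
by have := wf0 y; rewrite wx; lra.
Qed.

End HigsonCompactification.

(* The library's [compact_cover] is restricted to pointed spaces. *)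
Lemma compact_subcover (T : topologicalType) (K : set T) (I : choiceType)
    (D : set I) (O : I -> set T) :
  compact K -> (forall l, D l -> open (O l)) -> K `<=` \bigcup_(l in D) O l ->
  exists s : seq I, (forall l, l \in s -> D l) /\
    forall z, K z -> exists2 l, l \in s & O l z.
Proof.
have [->|/set0P[pt _]] := eqVneq K set0.
  by move=> _ _ _; exists [::].
pose T' : ptopologicalType := HB.pack (T : Type) T (isPointed.Build T pt).
have E : @compact T' K = @cover_compact T' K by rewrite compact_cover.
move=> cK oO KO; have : @compact T' K by [].
rewrite E => /(_ _ D O oO KO)[F FD KF].
exists (finmap.enum_fset F); split => [l lF|z /KF[l lF Ol]]; last by exists l.
by have := FD l lF; rewrite inE.
Qed.

(** Urysohn functions separate each point of [K] from [K] minus a member containing it. Finitely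
    many suffice by compactness; those with the same index are added and cut off at 1. They live on
    all of [T] so that they can be evaluated at points of [X] near the corona. *)
Lemma cover_functions (R : realType) (T : topologicalType) (K : set T) (n : nat)
    (U : 'I_n -> set T) :
  compact [set: T] -> hausdorff_space T -> closed K ->
  (forall l, open (U l)) -> K `<=` \bigcup_l U l ->
  exists p : 'I_n -> T -> R, [/\ forall l, continuous (p l),
    forall l z, 0 <= p l z <= 1,
    forall l z, K z -> ~ U l z -> p l z = 0 &
    forall z, K z -> exists l, 2^-1 < p l z].
Proof.
move=> cT hT clK oU KU.
have normT : normal_space T by exact: compact_normal.
have cK : compact K by apply: subclosed_compact cT _.
have /choice[f Hf] : forall zl : T * 'I_n, exists f : T -> R,
  K zl.1 -> U zl.2 zl.1 ->
    [/\ continuous f, forall t, 0 <= f t <= 1, f zl.1 = 1 &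
      forall t, K t -> ~ U zl.2 t -> f t = 0].
  move=> [z l] /=; have [[Kz Uz]|nKU] := pselect (K z /\ U l z); last first.
    by exists (fun=> 0) => Kz Uz; exfalso; apply: nKU.
  have c1 : closed [set z].
    by apply: accessible_closed_set1; exact: hausdorff_accessible.
  have c2 : closed (K `&` ~` U l) by apply: closedI => //; exact: open_closedC.
  have d12 : (K `&` ~` U l) `&` [set z] = set0.
    by rewrite -subset0 => t [[_ nU] tz]; apply: nU; rewrite tz.
  have := (@normal_separatorP R T).1 normT _ _ c2 c1 d12.
  move=> /(@uniform_separatorP _ R)[g [cg g01 g0 g1]].
  exists g => _ _; split => //.
  - by move=> t; have := g01 (g t) (ex_intro2 _ _ t I erefl); rewrite /= in_itv.
  - by apply: g1; exists z.
  - by move=> t Kt nU; apply: g0; exists t.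
pose D := [set zl : T * 'I_n | K zl.1 /\ U zl.2 zl.1].
pose O (zl : T * 'I_n) := f zl @^-1` [set t | 2^-1 < t].
have [||F [FH KF]] := @compact_subcover T K _ D O cK.
- move=> zl [Kz Uz]; have [cf _ _ _] := Hf zl Kz Uz.
  by apply: open_comp; [move=> t _; exact: cf|exact: open_gt].
- move=> z Kz; have [l _ Ul] := KU z Kz; exists (z, l) => //.
  have [_ _ f1 _] := Hf (z, l) Kz Ul; rewrite /O /preimage /= f1.
  by rewrite invf_lt1// ltr1n.
pose p l t := Num.min 1 (\sum_(zl <- F | (zl \in F) && (zl.2 == l)) f zl t).
have p0 l t : 0 <= \sum_(zl <- F | (zl \in F) && (zl.2 == l)) f zl t.
  apply: sumr_ge0 => zl /andP[/FH[Kz Uz] _].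
  by have [_ /(_ t) /andP[]] := Hf zl Kz Uz.
exists p; split.
- move=> l x; have cS : continuous (fun t : T =>
      \sum_(zl <- F | (zl \in F) && (zl.2 == l)) f zl t : R).
    apply: continuous_big => [|zl /andP[/FH[Kz Uz] _]]; last by have [] :=
      Hf zl Kz Uz.
    exact: add_continuous.
  by apply: (continuous_min _ (cS x)); exact: cst_continuous.
- by move=> l z; rewrite le_min ler01 p0 /= ge_min lexx.
- move=> l z Kz nU; rewrite /p big1 ?min_r ?ler01// =>
    zl /andP[/FH[Kz' Uz'] /eqP zll].
  by have [_ _ _ ->] := Hf zl Kz' Uz'; rewrite // zll.
- move=> z Kz; have [zl /= zlF fz] := KF z Kz; exists zl.2.
  rewrite lt_min invf_lt1 ?ltr1n//= (lt_le_trans fz)//.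
  rewrite (big_rem zl)//= zlF eqxx /= lerDl sumr_ge0// =>
    zl' /andP[/FH[Kz' Uz'] _].
  by have [_ /(_ z) /andP[]] := Hf zl' Kz' Uz'.
Qed.

Lemma card_finset (T : finType) (S : {set T}) :
  ([set x | x \in S] #= `I_#|S|)%card.
Proof.
rewrite (card_eqr card_II) .
have -> : [set x | x \in S] = @enum_val T (mem S) @` setT.
  apply/seteqP; split => [x /= xS|_ [l _ <-]]; last exact: enum_valP.
  by exists (enum_rank_in xS x) => //; rewrite enum_rankK_in.
by apply: inj_card_eq => a b _ _; exact: enum_val_inj.
Qed.

(** * Covering dimension of a subspace through indexed families of ambient open sets *)

Section SubspaceDimension.
Context (T : topologicalType) (K : set T).

Lemma covering_dim_le_family (m n : nat) (U : 'I_n -> set T) :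
  covering_dim_le (set_type K) m ->
  (forall l, open (U l)) -> K `<=` \bigcup_l U l ->
  exists (n' : nat) (V : 'I_n' -> set T) (s : 'I_n' -> 'I_n), [/\
    forall l, open (V l), K `<=` \bigcup_l V l,
    forall l z, K z -> V l z -> U (s l) z &
    forall z, K z -> (#|[set l | `[< V l z >]]%SET| <= m.+1)%N].
Proof.
move=> dm oU KU.
pose pre (W : set T) : set (set_type K) := set_val @^-1` W.
have [] := dm [set pre (U l) | l in setT].
  split.
  - exact/finite_image/finite_finset.
  - move=> _ [l _ <-]; exists (U l) => //.
  - rewrite -subTset => x _; have [l _ Ux] := KU _ (set_valP x).
    by exists (pre (U l)) => //; exists l.
move=> VV [[fV oV cV] rV ordV].
have [n' ] := (finite_setP VV).1 fV.
rewrite card_eq_sym => /card_set_bijP[f [fI finj fsurj]].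
have VVf (l : 'I_n') : VV (f l) by apply: fI => /=.
have /choice[V HV] : forall l : 'I_n', exists V, open V /\ pre V = f l.
  by move=> l; have [V ? ?] := oV _ (VVf l); exists V.
have /choice[s Hs] : forall l : 'I_n', exists l', f l `<=` pre (U l').
  by move=> l; have [_ [l' _ <-] ?] := rV _ (VVf l); exists l'.
have preE (W : set T) z (Kz : K z) : pre W (SigSub (mem_set Kz)) = W z.
  by [].
exists n', V, s; split.
- by move=> l; have [] := HV l.
- move=> z Kz; have : setT (SigSub (mem_set Kz)) by [].
  rewrite -cV => -[B VB Bz]; have [l ln fl] : exists2 l, (l < n')%N & f l = B.
    by have [l ? <-] := fsurj _ VB; exists l.
  exists (Ordinal ln) => //; rewrite -(preE _ _ Kz).
  by have [_ ->] := HV (Ordinal ln); rewrite /= fl.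
- move=> l z Kz Vz; rewrite -(preE _ _ Kz); apply: Hs.
  by have [_ <-] := HV l.
- move=> z Kz; rewrite -card_le_II; have E :=
    card_finset [set l | `[< V l z >]]%SET.
  rewrite -(card_le_eql E).
  have := ordV (SigSub (mem_set Kz)); apply: card_le_trans.
  have inj : {in [set x | x \in [set l | `[< V l z >]]%SET] &,
    injective (fun l : 'I_n' => f l)}.
    move=> a b _ _ /= fab; apply/val_inj; move: fab; apply: finj; rewrite inE/=;
      exact: ltn_ord.
  rewrite -(card_le_eql (inj_card_eq inj)); apply: subset_card_le.
  move=> _ [l /= + <-]; rewrite inE => /asboolP Vz; split => //.
  by have [_ <-] := HV l.
Qed.

Lemma family_covering_dim_le (m : nat) :
  (forall n (U : 'I_n -> set T),
    (forall l, open (U l)) -> K `<=` \bigcup_l U l ->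
    exists V : 'I_n -> set T, [/\
      forall l, open (V l), K `<=` \bigcup_l V l,
      forall l z, K z -> V l z -> U l z &
      forall z, K z -> (#|[set l | `[< V l z >]]%SET| <= m.+1)%N]) ->
  covering_dim_le (set_type K) m.
Proof.
move=> H UU [fU oU cU].
pose pre (W : set T) : set (set_type K) := set_val @^-1` W.
have [n ] := (finite_setP UU).1 fU.
rewrite card_eq_sym => /card_set_bijP[f [fI finj fsurj]].
have UUf (l : 'I_n) : UU (f l) by apply: fI => /=.
have /choice[U HU] : forall l : 'I_n, exists U, open U /\ pre U = f l.
  by move=> l; have [U ? ?] := oU _ (UUf l); exists U.
have preE (W : set T) z (Kz : K z) : pre W (SigSub (mem_set Kz)) = W z.
  by [].
have [||V [oV KV VU ordV]] := H n U.
- by move=> l; have [] := HU l.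
- move=> z Kz; have : setT (SigSub (mem_set Kz)) by [].
  rewrite -cU => -[B UB Bz]; have [l ln fl] : exists2 l, (l < n)%N & f l = B.
    by have [l ? <-] := fsurj _ UB; exists l.
  exists (Ordinal ln) => //; rewrite -(preE _ _ Kz).
  by have [_ ->] := HU (Ordinal ln); rewrite /= fl.
exists [set pre (V l) | l in setT]; split.
- split.
  + exact/finite_image/finite_finset.
  + by move=> _ [l _ <-]; exists (V l).
  + rewrite -subTset => x _; have [l _ Vx] := KV _ (set_valP x).
    by exists (pre (V l)) => //; exists l.
- move=> _ [l _ <-]; exists (f l) => // x Vx.
  by have [_ <-] := HU l; apply: VU => //; exact: set_valP.
- move=> x; apply: (@card_le_trans _ _ _ [set l | `[< V l (set_val x) >]]).
    apply:
      (@card_le_trans _ _ _ [set pre (V l) | l in [set l | `[< V l (set_val x)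
        >]]]).
      apply: subset_card_le => _ [[l _ <-] Vx]; exists l => //.
      exact/asboolP.
    exact: card_image_le.
  have := ordV _ (set_valP x);
    rewrite -card_le_II -(card_le_eql (card_finset _)).
  apply: card_le_trans; apply: subset_card_le => l /= ?.
  by rewrite inE.
Qed.

End SubspaceDimension.

(** * General position of finitely many vectors *)

Section GeneralPosition.
Context (R : realType) (n k : nat) (v : 'I_n -> 'rV[R]_k).

(** Padding by zeros gives a square matrix for every index set [T], including those with more than
    [k] elements. *)
Let vv (l : 'I_n) (j : nat) : R :=
  if insub j is Some j' then v l 0 j' else 0.

Let vvE l (j : 'I_k) : vv l j = v l 0 j.
Proof. by rewrite /vv valK. Qed.

(** Its columns are the first [#|T|] padded coordinates of [s] times the perturbed vectors; at
    [s = 0] it is a Vandermonde matrix. *)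
Let mat (T : {set 'I_n}) (s : R) : 'M[R]_#|T| :=
  \matrix_(j, r) ((enum_val r : 'I_n)%:R ^+ j + s * vv (enum_val r) j).

Let pol (T : {set 'I_n}) : {poly R} :=
  \det (\matrix_(j < #|T|, r < #|T|)
    (((enum_val r : 'I_n)%:R ^+ j)%:P + 'X * (vv (enum_val r) j)%:P)).

Let pol_horner T s : (pol T).[s] = \det (mat T s).
Proof.
rewrite /pol -[LHS]/(horner_eval s _) -det_map_mx; congr (\det _).
by apply/matrixP => j r; rewrite !mxE /= horner_evalE !hornerE.
Qed.

Let pol_neq0 T : pol T != 0.
Proof.
suff : (pol T).[0] != 0 by apply: contra_neq => ->; rewrite horner0.
rewrite pol_horner.
have -> : mat T 0 = Vandermonde #|T| (\row_r (enum_val r : 'I_n)%:R).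
  by apply/matrixP => j r; rewrite !mxE mul0r addr0.
rewrite det_Vandermonde; apply/prodf_neq0 => a _; apply/prodf_neq0 => b ab.
rewrite !mxE subr_eq0 eqr_nat; apply: contraTneq ab => /val_inj/enum_val_inj ->.
by rewrite ltnn.
Qed.

(* The family [v l + s^-1 (1, l, ..., l^(k-1))] is in general position for all
   but finitely many [s]: up to a power of [s], its minors are polynomials in
   [s] whose constant terms are Vandermonde determinants. *)
Lemma general_position (eps : R) : 0 < eps ->
  exists (v' : 'I_n -> 'rV[R]_k) (c : R), [/\ 0 < c,
    forall l j, `|v' l 0 j - v l 0 j| <= eps &
    forall lam : 'I_n -> R, (forall l, 0 <= lam l) ->
      (#|[set l | lam l != 0%R]%SET| <= k)%N ->
      c * \sum_l lam l <= eucl_norm (\sum_l lam l *: v' l)].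
Proof.
(* For [s > B] the perturbation [l ^ j / s] is at most [n ^ k / s], hence at most [eps]. *)
move=> eps0; pose B := ((n ^ k)%N%:R / eps : R).
pose N := (Num.truncn B).+1.
have BN : B < N%:R by exact: truncnS_gt.
pose Q := \prod_(T : {set 'I_n}) pol T.
have Q0 : Q != 0 by apply/prodf_neq0 => T _; exact: pol_neq0.
have [s Bs Qs] : exists2 s : R, B < s & Q.[s] != 0.
  apply: contrapT => H.
  (* These [size Q] distinct candidates outnumber the roots of [Q]. *)
  pose rs := [seq (N + t)%:R : R | t <- iota 0 (size Q)].
  have /(max_poly_roots Q0) : all (root Q) rs.
    apply/allP => _ /mapP[t _ ->]; apply: contrapT => /negP Qt.
    apply: H; exists (N + t)%:R; last by move: Qt; rewrite rootE.
    by rewrite (lt_le_trans BN)// ler_nat leq_addr.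
  rewrite size_map size_iota ltnn => F; apply/notF/F.
  rewrite map_inj_uniq ?iota_uniq// => a b /eqP.
  by rewrite eqr_nat eqn_add2l => /eqP.
have s0 : 0 < s by apply: le_lt_trans Bs; rewrite /B divr_ge0// ltW.
have Mu T : mat T s \in unitmx.
  rewrite unitmxE unitfE -pol_horner.
  by move: Qs; rewrite horner_prod => /prodf_neq0/(_ T isT).
(* Summing over all [T] makes the lower bound independent of the support of [lam]. *)
pose D := 1 + \sum_(T : {set 'I_n}) \sum_r \sum_j `|invmx (mat T s) r j|.
have D0 : 0 < D.
  by rewrite ltr_wpDr// !sumr_ge0// => T _; rewrite sumr_ge0// => r _;
    rewrite sumr_ge0.
pose v' l : 'rV[R]_k := \row_j (v l 0 j + (l : nat)%:R ^+ j / s).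
exists v', (s * D)^-1; split.
- by rewrite invr_gt0 mulr_gt0.
- move=> l j; rewrite mxE addrC addKr ger0_norm; last first.
    by rewrite divr_ge0 ?exprn_ge0 ?(ltW s0).
  rewrite ler_pdivrMr// mulrC -ler_pdivrMr//; apply: le_trans (ltW Bs).
  rewrite ler_pM2r ?invr_gt0// -natrX ler_nat.
  rewrite (@leq_trans (n ^ j))//; first by case: (nat_of_ord j) => [//|q];
    rewrite leq_exp2r// ltnW.
  apply: leq_pexp2l; first exact: leq_ltn_trans (leq0n l) (ltn_ord l).
  exact: ltnW (ltn_ord j).
move=> lam lam0; set T := finset _ => Tk.
set w := \sum_l lam l *: v' l.
have sumT (F : 'I_n -> R) :
  \sum_l lam l * F l = \sum_(r < #|T|) lam (enum_val r) * F (enum_val r).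
  rewrite -(big_enum_val (fun l => lam l * F l)) [LHS](bigID (mem T))/=.
  rewrite [X in _ + X]big1 ?addr0// => l; rewrite inE negbK => /eqP ->.
  by rewrite mul0r.
pose mu : 'cV[R]_#|T| := \col_r lam (enum_val r).
(* [mat T s] sends the coefficients to coordinates of [s] times [w], so its inverse recovers them
   with a bound in terms of the norm of [w]. *)
have wE (j : 'I_#|T|) : `|(mat T s *m mu) j 0| <= s * eucl_norm w.
  pose j' := widen_ord Tk j.
  have -> : (mat T s *m mu) j 0 = s * w 0 j'.
    rewrite !mxE summxE mulr_sumr.
    transitivity (\sum_l lam l * ((l : nat)%:R ^+ j + s * vv l j)).
      by rewrite sumT; apply: eq_bigr => r _; rewrite !mxE mulrC.
    apply: eq_bigr => l _; rewrite !mxE -(vvE l j') /=.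
    by field; rewrite gt_eqF.
  by rewrite normrM gtr0_norm// ler_pM2l//; exact: coord_le_eucl_norm.
rewrite mulrC ler_pdivrMr ?mulr_gt0// mulrCA mulrC.
have -> : \sum_l lam l = \sum_r mu r 0.
  have := sumT (fun=> 1); rewrite (eq_bigr lam) => [->|l _];
    last by rewrite mulr1.
  by apply: eq_bigr => r _; rewrite mxE mulr1.
have sN0 : 0 <= s * eucl_norm w by rewrite mulr_ge0 ?eucl_norm_ge0// ltW.
rewrite -(mulKmx (Mu T) mu).
apply:
  (@le_trans _ _ (\sum_r \sum_j `|invmx (mat T s) r j| * (s * eucl_norm w))).
  apply: ler_sum => r _; rewrite mxE (le_trans (ler_norm _))//.
  rewrite (le_trans (ler_norm_sum _ _ _))//; apply: ler_sum => j _.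
  by rewrite normrM ler_wpM2l.
under eq_bigr do rewrite -mulr_suml.
have -> : eucl_norm w * D * s = D * (s * eucl_norm w) by ring.
rewrite -mulr_suml ler_wpM2r//.
rewrite /D (bigD1 T)//= addrCA lerDl addr_ge0// sumr_ge0// => T' _.
by rewrite sumr_ge0// => r _; rewrite sumr_ge0.
Qed.

End GeneralPosition.

Lemma le_sum_norm (R : realType) (I : finType) (C : I -> R) j :
  C j <= \sum_j `|C j|.
Proof.
by rewrite (le_trans (ler_norm _))// (bigD1 j)//= lerDl sumr_ge0.
Qed.

(** * From a nonvanishing approximation to a norm-preserving extension *)

Section ExtendOffZero.
Context (R : realType) (X : metricType R) (x0 : X) (m : nat).

(* [H] is [G] with its deviation from [F] truncated at [t]: it agrees with [F]
   where [|F| >= 3/4 |x|], in particular far out in [A], and with [G] where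
   [|F| <= |x|/2]; in between, [F] is so large that [H] cannot vanish. *)
Lemma extend_off_zero (A E : set X) (f F G : X -> 'rV[R]_m.+1) (M c : R) :
  norm_preserving_on x0 A f ->
  (forall j, al setT (fun x => F x 0 j)) ->
  (forall x j, A x -> `|f x 0 j - F x 0 j| <= M) ->
  far x0 E -> (forall j, al E (fun x => G x 0 j)) ->
  0 < c -> (forall x, E x -> c * wt x0 x <= eucl_norm (G x)) ->
  (forall x j, E x ->
    `|G x 0 j - F x 0 j| <= (4 * m.+1%:R)^-1 * wt x0 x) ->
  exists g : X -> 'rV[R]_m.+1, [/\ forall x, A x -> g x = f x,
    norm_preserving_on x0 setT g & asymp_lipschitz_on setT g].
Proof.
move=> npf alF fF farE alG c0 Gc GF.
have k0 : 0 < m.+1%:R :> R by rewrite ltr0n.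
have alNF : al setT (fun x => eucl_norm (F x)) by exact: al_eucl_norm.
pose t x := Num.max 0 (3 / 4 * wt x0 x - eucl_norm (F x)).
have t0 x : 0 <= t x by rewrite le_max lexx.
pose H x : 'rV[R]_m.+1 := \row_j
  (F x 0 j + Num.max (- t x) (Num.min (t x) (G x 0 j - F x 0 j))).
have alH j : al E (fun x => H x 0 j).
  have alt : al E t.
    apply: al_max; first exact: al_cst.
    apply: al_sub_fun; first by apply: al_scale; exact: al_wt.
    exact: al_sub alNF.
  apply: (@al_ext _ _ _ (fun x => F x 0 j +
      Num.max (- t x) (Num.min (t x) (G x 0 j - F x 0 j)))).
    by move=> x _; rewrite mxE.
  apply: al_add; first exact: al_sub (alF j).
  apply: al_max; first exact: al_opp.
  by apply: al_min => //; apply: al_sub_fun => //; exact: al_sub (alF j).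
have HF x j : `|H x 0 j - F x 0 j| <= `|G x 0 j - F x 0 j|.
  rewrite mxE addrAC subrr add0r; have := t0 x; move: (t x) (G x 0 j - _) =>
    s d s0.
  have dd : - `|d| <= d by rewrite lerNl -normrN ler_norm.
  have d0 : - `|d| <= 0 by rewrite oppr_le0.
  rewrite ler_norml le_max le_min ge_max ge_min dd ler_norm (le_trans d0 s0).
  by rewrite !orbT andbT /= (le_trans _ (normr_ge0 d))// oppr_le0.
have HG x : (forall j, `|G x 0 j - F x 0 j| <= t x) -> H x = G x.
  move=> Gt; apply/rowP => j; rewrite mxE; have := Gt j; rewrite ler_norml =>
    /andP[? ?].
  by rewrite min_r// max_r// addrCA subrr addr0.
pose c' := Num.min c 4^-1.
have c'0 : 0 < c' by rewrite lt_min c0 invr_gt0 ltr0n.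
have Hc x : E x -> c' * wt x0 x <= eucl_norm (H x).
  move=> Ex; have w0 := wt_gt0 x0 x.
  have [Fs|Fl] := leP (eucl_norm (F x)) (2^-1 * wt x0 x).
    rewrite HG => [|j].
      by rewrite (le_trans _ (Gc x Ex))// ler_pM2r// ge_min lexx.
    rewrite (le_trans (GF x j Ex))// le_max; apply/orP; right.
    have : (4 * m.+1%:R)^-1 * wt x0 x <= 4^-1 * wt x0 x.
      by rewrite ler_pM2r// lef_pV2 ?posrE ?mulr_gt0// ler_peMr// ler1n.
    by move=> /le_trans; apply; lra.
  (* Here the norm of [F x] exceeds [wt / 2], and the coordinate errors change it by at most
     [wt / 4]. *)
  have := @eucl_norm_dist_le _ _ (H x) (F x) _ (fun j =>
    le_trans (HF x j) (GF x j Ex)).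
  have -> : m.+1%:R * ((4 * m.+1%:R)^-1 * wt x0 x) = 4^-1 * wt x0 x.
    by field; rewrite gt_eqF.
  have : c' * wt x0 x <= 4^-1 * wt x0 x by rewrite ler_pM2r// ge_min lexx orbT.
  by rewrite ler_distl => ? /andP[? ?]; lra.
pose E' x := [/\ E x, 4 * (m.+1%:R * M) <= wt x0 x & wt x0 x = ptnorm x0 x].
have farE' : far x0 E'.
  near=> x; split; near: x; [exact: farE|exact: far_ge_wt|exact: far_wt].
have H0 x : E' x -> 0 < eucl_norm (H x).
  by move=> [Ex _ _]; rewrite (lt_le_trans _ (Hc x Ex))// mulr_gt0// wt_gt0.
have NF x :
  A x -> ptnorm x0 x - m.+1%:R * M <= eucl_norm (F x) <= ptnorm x0 x + m.+1%:R *
    M.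
  move=> Ax; have := @eucl_norm_dist_le _ _ (f x) (F x) M (fun j => fF x j Ax).
  by rewrite (npf x Ax) ler_distl => /andP[? ?]; apply/andP; split; lra.
have HFA x : A x -> E' x -> H x = F x.
  move=> Ax [_ Mw wE]; have /andP[NFx _] := NF x Ax.
  have tx : t x = 0.
    by apply/max_idPl; rewrite wE in Mw *; lra.
  by apply/rowP => j; rewrite mxE tx oppr0 max_l ?ge_min ?lexx// addr0.
pose h x : 'rV[R]_m.+1 := (ptnorm x0 x / eucl_norm (H x)) *: H x.
have alh j : al E' (fun x => h x 0 j).
  apply: (@al_ext _ _ _ (fun x => ptnorm x0 x * H x 0 j / eucl_norm (H x))).
    by move=> x _; rewrite /h [RHS]mxE mulrAC.
  have E'E : E' `<=` E by move=> x [].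
  apply: (@al_ratio _ _ _ _ _ _ (1 + c'^-1)) => //.
  - exact: al_sub (alH j).
  - exact: al_ptnorm.
  - by apply: al_eucl_norm => j'; exact: al_sub (alH j').
  - move=> x Ex; rewrite (le_trans (coord_le_eucl_norm _ _))//.
    by rewrite ler_peMl ?eucl_norm_ge0// lerDl invr_ge0 ltW.
  - move=> x Ex; rewrite ger0_norm ?ptnorm_ge0//
      (le_trans (ptnorm_le_wt _ _))//.
    rewrite (@le_trans _ _ (c'^-1 * eucl_norm (H x)))//.
      by rewrite ler_pdivlMl//; apply: Hc; case: Ex.
    by rewrite ler_wpM2r ?eucl_norm_ge0// lerDr.
(* Where [H] vanishes any vector of the right norm will do: this happens only outside [E'], that is,
   at bounded norm. *)
pose g x := if `[< A x >] then f x else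
  if eucl_norm (H x) == 0 then ptnorm x0 x *: delta_mx 0 0 else h x.
have gA x : A x -> g x = f x by move=> Ax; rewrite /g asboolT.
have npg : norm_preserving_on x0 setT g.
  move=> x _; have [Ax|nAx] := pselect (A x); first by rewrite gA// npf.
  rewrite /g asboolF//; case: eqP => [_|/eqP H1].
    rewrite eucl_normZ ger0_norm ?ptnorm_ge0// /eucl_norm (bigD1 0)//= big1 =>
      [|j /negbTE j0].
      by rewrite !mxE !eqxx expr1n addr0 sqrtr1 mulr1.
    by rewrite !mxE j0 andbF expr0n.
  rewrite eucl_normZ ger0_norm ?divr_ge0 ?ptnorm_ge0 ?eucl_norm_ge0//.
  by rewrite divfK.
exists g; split => //; apply/asymp_lipschitz_onP => j.
apply: (@al_far _ _ x0 E' _ 1) => //; last first.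
  move=> x; rewrite mul1r (le_trans (coord_le_eucl_norm _ _))// npg//.
  exact: ptnorm_le_wt.
pose b := m.+1%:R * `|M| + `|M|.
apply: (@al_close _ _ _ (fun x => h x 0 j) _ b) => [x Ex|//].
have [Ax|nAx] := pselect (A x); last first.
  rewrite /g asboolF// gt_eqF ?H0// subrr normr0.
  by rewrite addr_ge0// mulr_ge0.
have MM := ler_norm M; have H1 := H0 x Ex; have NFx := NF x Ax.
rewrite gA// mxE HFA// in H1 *.
(* On [A] both [F] and its norm are within a bounded error of [f] and its norm, so normalizing [F]
   moves it only boundedly away from [f]. *)
have -> : ptnorm x0 x / eucl_norm (F x) * F x 0 j - f x 0 j =
    (ptnorm x0 x - eucl_norm (F x)) * (F x 0 j / eucl_norm (F x)) -
    (f x 0 j - F x 0 j).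
  by field; rewrite gt_eqF.
rewrite (le_trans (ler_normB _ _))// lerD//; last exact:
  le_trans (fF x j Ax) MM.
rewrite normrM -[leRHS]mulr1; apply: ler_pM => //.
  have : m.+1%:R * M <= m.+1%:R * `|M| by rewrite ler_pM2l.
  by move: NFx => /andP[? ?] ?; rewrite ler_norml; apply/andP; split; lra.
by rewrite normrM normfV (gtr0_norm H1) ler_pdivrMr// mul1r; exact:
  coord_le_eucl_norm.
Unshelve. all: by end_near. Qed.

End ExtendOffZero.

(** * From the dimension of the corona to the extension property *)

Section Families.
Context (R : realType) (X : metricType R) (x0 : X) (hX : topologicalType).
Context (i : X -> hX).
Hypothesis hi : higson_sublinear_compactification x0 i.

Lemma al_family_extends (I : finType) (E : set X) (u : I -> X -> R) :
  (forall j, al E (u j)) ->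
  exists (F : I -> hX -> R) (C : R), (forall j, continuous (F j)) /\
    forall j x, E x -> `|u j x - wt x0 x * F j (i x)| <= C.
Proof.
move=> alu.
have /choice[FC HFC] : forall j, exists FC : (hX -> R) * R, continuous FC.1 /\
    forall x, E x -> `|u j x - wt x0 x * FC.1 (i x)| <= FC.2.
  by move=> j; have [F [C H]] := al_extends hi (alu j); exists (F, C).
exists (fun j => (FC j).1), (\sum_j `|(FC j).2|); split => [j|j x Ex].
  by have [] := HFC j.
by rewrite (le_trans ((HFC j).2 x Ex))// (le_sum_norm (fun j => (FC j).2)).
Qed.

Lemma al_family_approx (I : finType) (p : I -> hX -> R) (eps : R) : 0 < eps ->
  (forall j, continuous (p j)) -> (forall j z, 0 <= p j z <= 1) ->
  exists (u : I -> X -> R) (C : R), (forall j, al setT (u j)) /\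
    forall j x, `|u j x - wt x0 x * p j (i x)| <= eps * wt x0 x + C.
Proof.
move=> eps0 cp p01.
have /choice[uC HuC] : forall j, exists uC : (X -> R) * R, al setT uC.1 /\
    forall x, `|uC.1 x - wt x0 x * p j (i x)| <= eps * wt x0 x + uC.2.
  by move=> j; have [u [C H]] := al_approx hi (cp j) (p01 j) eps0; exists (u,
    C).
exists (fun j => (uC j).1), (\sum_j `|(uC j).2|); split => [j|j x].
  by have [] := HuC j.
rewrite (le_trans ((HuC j).2 x))// lerD2l.
by rewrite (le_sum_norm (fun j => (uC j).2)).
Qed.

(** A neighbourhood of [i x] that meets [X] inside the unit ball around [x] contains no corona
    point, since every neighbourhood of such a point contains points arbitrarily far out. *)
Lemma closed_corona : proper_space X -> closed (~` range i).
Proof.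
move=> prX; rewrite closedC openE => z [x _ <-]; have [ci _] := hi.
have [V oV Vx] := (let: And5 _ _ _ h _ :=
  ci in (h (ball x 1)°).1) (@open_interior _ _).
have nV : nbhs (i x) V.
  apply: open_nbhs_nbhs; split => //.
  by have : (i @^-1` V) x by rewrite Vx; exact: nbhsx_ballx.
apply: filterS nV => {}z Vz; apply: contrapT => nz.
have nVz : nbhs z V by exact: open_nbhs_nbhs.
have [y /= xy Vy] :=
  far_near_corona ci nz nVz (far_gt x0 (ptnorm x0 x + 1)) prX.
have : (i @^-1` V) y by [].
rewrite Vx => /interior_subset; rewrite ballEmdist /= => dxy.
have := ptnorm_triangle x0 y x; rewrite (metric_sym y x) => h1.
by move: xy; rewrite ltNge (le_trans h1)// lerD2l ltW.
Qed.

Lemma near_dist_lt (T : topologicalType) (F : T -> R) (z : T) (c e : R) :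
  continuous F -> `|F z - c| < e -> \forall z' \near z, `|F z' - c| < e.
Proof.
move=> cF Fz.
have d0 : 0 < e - `|F z - c| by rewrite subr_gt0.
have /cvgrPdist_lt/(_ _ d0) := cF z; apply: filterS => z'.
rewrite distrC ltrBrDr; apply: le_lt_trans.
by rewrite (le_trans _ (ler_normD _ _))// addrA subrK.
Qed.

Lemma near_lt (T : topologicalType) (F : T -> R) (z : T) (e : R) :
  continuous F -> F z < e -> \forall z' \near z, F z' < e.
Proof.
move=> cF Fz; apply: (cF z [set t | t < e]); exact: open_nbhs_nbhs.
Qed.

Lemma near_gt (T : topologicalType) (F : T -> R) (z : T) (e : R) :
  continuous F -> e < F z -> \forall z' \near z, e < F z'.
Proof.
move=> cF Fz; apply: (cF z [set t | e < t]); exact: open_nbhs_nbhs.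
Qed.

(** [G] is [wt] times a weighted average of vectors [v' l] in general position, close to the values
    of the extension of [F / wt] on a fine cover of the corona. *)
Lemma avoid_zero (m : nat) (F : X -> 'rV[R]_m.+1) (eps : R) :
  proper_space X -> covering_dim_le (corona i) m ->
  (forall j, al setT (fun x => F x 0 j)) -> 0 < eps ->
  exists (E : set X) (G : X -> 'rV[R]_m.+1) (c : R), [/\ far x0 E, 0 < c,
    forall j, al E (fun x => G x 0 j),
    forall x, E x -> c * wt x0 x <= eucl_norm (G x) &
    forall x j, E x -> `|G x 0 j - F x 0 j| <= eps * wt x0 x].
Proof.
move=> prX dm alF eps0; set K := ~` range i.
have cT : compact [set: hX] by case: hi => -[].
have hT : hausdorff_space hX by case: hi => -[].
have clK : closed K by exact: closed_corona.
have cK : compact K by apply: subclosed_compact cT _.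
have [Phi [C [cPhi PhiF]]] := al_family_extends alF.
(* One share each for the oscillation of [Phi] on a cover member, the move to general position, and
   the distance between [F] and [wt * Phi]. *)
pose e := eps / 3; have e0 : 0 < e by rewrite divr_gt0.
pose O (z : hX) := [set z' | forall j, `|Phi j z' - Phi j z| < e].
have oO z : open (O z).
  rewrite openE => z' Oz'; apply: filter_forall => j.
  exact: near_dist_lt.
have [||s [sK sO]] := @compact_subcover hX K _ K O cK.
- by move=> z _.
- by move=> z Kz; exists z => // j; rewrite subrr normr0.
have [||n [V [sg [oV KV VO ordV]]]] := @covering_dim_le_family hX K m (size s)
    (fun l => O (tnth (in_tuple s) l)) dm.
- by move=> l; exact: oO.
- by move=> z /sO[y ys Oy]; have /seq_tnthP[l yl] := ys; exists l; rewrite //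
    -yl.
pose v l : 'rV[R]_m.+1 := \row_j Phi j (tnth (in_tuple s) (sg l)).
have Vv l z j : K z -> V l z -> `|Phi j z - v l 0 j| < e.
  by move=> Kz Vz; rewrite mxE; exact: VO.
have [v' [c [c0 v'v v'c]]] := general_position v e0.
have [p [cp p01 pK pcov]] := @cover_functions R hX K n V cT hT clK oV KV.
have [|u [D [alu uD]]] := al_family_approx (eps := 8^-1) _ cp p01.
  by rewrite invr_gt0.
pose w := wt x0; have w0 x : 0 < w x by exact: wt_gt0.
(* On [E] below, [u l] is within [3/16 * w] of [w * p l]. With the threshold [1/4], a nonzero weight
   forces [p l] to be at least [1/16], and [p l > 1/2] gives a weight of at least [w / 16]. *)
pose q l x := Num.max (u l x - 4^-1 * w x) 0.
have q0 l x : 0 <= q l x by rewrite le_max lexx orbT.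
pose Q x := \sum_l q l x.
(* The indices active at [z'] belong to members containing one corona point [z], so the order of the
   cover at [z] bounds their number. For fixed [z] the conditions persist nearby, so they reach
   points of [X] far out. *)
pose P z' := exists z, [/\ K z,
  forall l, 16^-1 <= p l z' -> V l z /\ forall j, `|Phi j z' - v l 0 j| < e &
  exists l, 2^-1 < p l z'].
have nP z : ~ range i z -> \forall z' \near z, P z'.
  move=> Kz; have [l0 pl0] := pcov z Kz.
  have nV l : \forall z' \near z,
      16^-1 <= p l z' -> V l z /\ forall j, `|Phi j z' - v l 0 j| < e.
    have [Vz|nVz] := pselect (V l z).
      have nPhi : \forall z' \near z, forall j, `|Phi j z' - v l 0 j| < e.
        by apply: filter_forall => j; apply: near_dist_lt => //; exact: Vv.
      by apply: filterS nPhi.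
    have : \forall z' \near z, p l z' < 16^-1.
      by apply: near_lt => //; rewrite pK// invr_gt0.
    by apply: filterS => z'; rewrite ltNge => /negP.
  near=> z'; exists z; split => //; last by exists l0; near: z'; exact: near_gt.
  by near: z'; exact: filter_forall.
pose E := [set x | [/\ P (i x), D * 16 <= w x & C / e <= w x]].
have farE : far x0 E.
  near=> x; split; near: x; [|exact: far_ge_wt|exact: far_ge_wt].
  exact: near_corona_far hi.1 _ nP.
have uE l x : E x -> `|u l x - w x * p l (i x)| <= 3 / 16 * w x.
  by move=> [_ Dw _]; rewrite (le_trans (uD l x))// -/w; lra.
have qp l x : E x -> q l x != 0 -> 16^-1 <= p l (i x).
  move=> Ex; have := uE l x Ex; rewrite /q ler_distl => /andP[_ up].
  have [qq|qq _] := leP (u l x - 4^-1 * w x) 0; first by move=> /eqP.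
  rewrite -(ler_pM2l (w0 x)); lra.
have QE x : E x -> 16^-1 * w x <= Q x.
  move=> Ex; have [[z [_ _ [l pl]]] _ _] := Ex.
  rewrite /Q (bigD1 l)//= (le_trans (y := q l x))// ?lerDl ?sumr_ge0//.
  rewrite /q le_max; apply/orP; left.
  have := uE l x Ex; rewrite ler_distl => /andP[up _].
  by move: pl; rewrite -(ltr_pM2l (w0 x)); lra.
have Q0 x : E x -> 0 < Q x.
  by move=> Ex; rewrite (lt_le_trans _ (QE x Ex))// mulr_gt0// invr_gt0.
have alq l : al E (q l).
  apply: al_max; last exact: al_cst.
  apply: al_sub_fun; first exact: al_sub (alu l).
  by apply: al_scale; exact: al_wt.
pose a j x := \sum_l v' l 0 j * q l x.
pose G x : 'rV[R]_m.+1 := \row_j (w x * a j x / Q x).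
have GQ x : G x = (w x / Q x) *: \sum_l q l x *: v' l.
  apply/rowP => j; rewrite !mxE summxE mulrAC; congr (_ * _).
  by apply: eq_bigr => l _; rewrite mxE mulrC.
exists E, G, c; split => //.
- move=> j; apply: (@al_ext _ _ _ (fun x => w x * a j x / Q x)).
    by move=> x _; rewrite mxE.
  apply: (@al_ratio _ _ _ _ _ _ (16 + \sum_l `|v' l 0 j|)) => //.
  + by apply: al_sum => l; exact: al_scale.
  + exact: al_wt.
  + exact: al_sum.
  + move=> x Ex; rewrite mulrDl ler_wpDl//; first by rewrite mulr_ge0// ltW//
      Q0.
    rewrite mulr_suml (le_trans (ler_norm_sum _ _ _))//; apply: ler_sum => l _.
    rewrite normrM ler_wpM2l// ger0_norm// /Q (bigD1 l)//= lerDl.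
    exact: sumr_ge0.
  + move=> x Ex; rewrite gtr0_norm// mulrDl ler_wpDr//.
      by rewrite mulr_ge0// ?sumr_ge0// ltW// Q0.
    by rewrite -ler_pdivrMl// QE.
- move=> x Ex; rewrite GQ eucl_normZ gtr0_norm ?divr_gt0 ?Q0//.
  rewrite [leRHS]mulrC mulrA ler_pdivlMr ?Q0// mulrAC ler_pM2r//.
  (* At most [m + 1] weights are nonzero, as the general position bound requires in dimension
     [m + 1]. *)
  apply: v'c => //; have [[z [Kz HV _]] _ _] := Ex.
  apply: leq_trans (ordV z Kz); apply: subset_leq_card.
  apply/fintype.subsetP => l; rewrite !inE => ql.
  have [Vz _] := HV l (qp l x Ex ql).
  exact: Vz.
move=> x j Ex; have [[z [Kz HV _]] _ Cw] := Ex.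
have FPhi : `|w x * Phi j (i x) - F x 0 j| <= e * w x.
  rewrite distrC (le_trans (PhiF j x I))//.
  by move: Cw; rewrite ler_pdivrMr// mulrC.
have GPhi : `|G x 0 j - w x * Phi j (i x)| <= 2 * e * w x.
  have -> : G x 0 j - w x * Phi j (i x) =
      w x * (\sum_l (v' l 0 j - Phi j (i x)) * q l x) / Q x.
    rewrite mxE; have -> :
      \sum_l (v' l 0 j - Phi j (i x)) * q l x = a j x - Phi j (i x) * Q x.
      by rewrite mulr_sumr -sumrB; apply: eq_bigr => l _; rewrite mulrBl.
    by field; rewrite gt_eqF ?Q0.
  rewrite -mulrA mulrC normrM (gtr0_norm (w0 x)) ler_pM2r//.
  rewrite normrM normfV (gtr0_norm (Q0 x Ex)) ler_pdivrMr ?Q0//.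
  rewrite (le_trans (ler_norm_sum _ _ _))// mulr_sumr; apply: ler_sum => l _.
  rewrite normrM (ger0_norm (q0 l x)).
  have [->|ql] := eqVneq (q l x) 0; first by rewrite !mulr0.
  rewrite ler_wpM2r//; have [_ /(_ j)] := HV l (qp l x Ex ql).
  by have := v'v l j; rewrite ler_distl ltr_distl ler_distl =>
    /andP[? ?] /andP[? ?]; apply/andP; split; lra.
have -> : eps = 2 * e + e by rewrite /e; lra.
have -> :
  G x 0 j - F x 0 j = (G x 0 j - w x * Phi j (i x)) + (w x * Phi j (i x) - F x 0
    j).
  by rewrite addrA subrK.
by rewrite (le_trans (ler_normD _ _))// mulrDl lerD.
Unshelve. all: by end_near. Qed.

Lemma dim_le_extension (m : nat) : proper_space X ->
  covering_dim_le (corona i) m -> extension_property x0 m.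
Proof.
move=> prX dm A f npf /asymp_lipschitz_onP alf.
have /choice[F' HF] : forall j, exists F' : (X -> R) * R, al setT F'.1 /\
    forall x, A x -> `|f x 0 j - F'.1 x| <= F'.2.
  move=> j; have [F [K [M [K0 FK fF]]]] := al_smoothing (alf j).
  by exists (F, M); split => //; exact: lip_al FK.
pose F x : 'rV[R]_m.+1 := \row_j (F' j).1 x.
have alF j : al setT (fun x => F x 0 j).
  apply: (@al_ext _ _ _ (F' j).1) => [x _|]; first by rewrite mxE.
  by have [] := HF j.
have fF x j : A x -> `|f x 0 j - F x 0 j| <= \sum_j `|(F' j).2|.
  move=> Ax; rewrite mxE (le_trans ((HF j).2 x Ax))//.
  by rewrite (le_sum_norm (fun j => (F' j).2)).
have [|E [G [c [farE c0 alG Gc GF]]]] := avoid_zero (eps :=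
  (4 * m.+1%:R)^-1) prX dm alF.
  by rewrite invr_gt0 mulr_gt0.
exact: extend_off_zero npf alF fF farE alG c0 Gc GF.
Qed.

End Families.

(* It suffices to shrink one (m+2)-tuple of members of the cover at a time; the
   members outside the tuple are absorbed into its last entry. *)
Lemma order_of_shrinkings (T : topologicalType) (K : set T) (m : nat) :
  (forall W : 'I_m.+2 -> set T,
    (forall l, open (W l)) -> K `<=` \bigcup_l W l ->
    exists W' : 'I_m.+2 -> set T, [/\ forall l, open (W' l),
      K `<=` \bigcup_l W' l, forall l z, K z -> W' l z -> W l z &
      forall z, K z -> exists l, ~ W' l z]) ->
  covering_dim_le (set_type K) m.
Proof.
move=> shr; apply: family_covering_dim_le => n U oU KU.
have step (U' : 'I_n -> set T) (s : {ffun 'I_m.+2 -> 'I_n}) :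
    (forall l, open (U' l)) -> K `<=` \bigcup_l U' l -> injective s ->
    exists V : 'I_n -> set T, [/\ forall l, open (V l),
      K `<=` \bigcup_l V l, forall l z, K z -> V l z -> U' l z &
      forall z, K z -> exists l, ~ V (s l) z].
  move=> oU' KU' sI; pose rest := \bigcup_(j in [set j | forall l,
    s l != j]) U' j.
  pose W l := if l == ord_max then U' (s l) `|` rest else U' (s l).
  have [||W' [oW' KW' W'W W'0]] := shr W.
  - move=> l; rewrite /W; case: ifP => _ //; apply: openU => //.
    by apply: bigcup_open => j _; exact: oU'.
  - move=> z /KU'[j _ Uj]; have [[l sl]|ns] := pselect (exists l, s l = j).
      by exists l => //; rewrite /W; case: ifP => _; rewrite sl //; left.
    exists ord_max => //; rewrite /W eqxx; right; exists j => // l.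
    by apply/eqP => sl; apply: ns; exists l.
  pose V j := if [pick l | s l == j] is Some l then W' l `&` U' j else U' j.
  have Vs l : V (s l) = W' l `&` U' (s l).
    rewrite /V; case: pickP => [l' /eqP/sI -> //|/(_ l)]; by rewrite eqxx.
  have Vn j : (forall l, s l != j) -> V j = U' j.
    by move=> nj; rewrite /V; case: pickP => // l; rewrite (negbTE (nj l)).
  exists V; split.
  - by move=> j; rewrite /V; case: pickP => // l _; exact: openI.
  - move=> z Kz; have [l _ Wl] := KW' z Kz; have := W'W l z Kz Wl.
    rewrite /W; case: eqP => [_ [Ul|[j nj Uj]]|_ Ul].
    + by exists (s l) => //; rewrite Vs.
    + by exists j => //; rewrite Vn.
    + by exists (s l) => //; rewrite Vs.
  - by move=> j z _; rewrite /V; case: pickP => // l _ [].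
  - by move=> z Kz; have [l nl] := W'0 z Kz; exists l; rewrite Vs => -[].
(* Later shrinkings only make the sets smaller, so empty intersections obtained earlier persist. *)
have steps (r : seq {ffun 'I_m.+2 -> 'I_n}) :
    exists V : 'I_n -> set T, [/\ forall l, open (V l),
      K `<=` \bigcup_l V l, forall l z, K z -> V l z -> U l z &
      forall s, s \in r -> injective s -> forall z, K z -> exists l,
        ~ V (s l) z].
  elim: r => [|s r [V [oV KV VU Vr]]]; first by exists U; split.
  have [sI|nsI] := pselect (injective s); last first.
    exists V; split => // s'; rewrite inE => /orP[/eqP -> //|]; exact: Vr.
  have [V' [oV' KV' V'V V's]] := step V s oV KV sI.
  exists V'; split => //.
  - by move=> l z Kz /V'V/VU; apply.
  - move=> s'; rewrite inE => /orP[/eqP -> _ z Kz|s'r s'I z Kz]; first exact: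
      V's.
    by have [l nV] := Vr s' s'r s'I z Kz; exists l => /(V'V _ _ Kz).
have [V [oV KV VU Vs]] := steps (enum {: {ffun 'I_m.+2 -> 'I_n}}).
exists V; split => // z Kz; rewrite leqNgt; apply/negP => mV.
set S := finset _ in mV.
(* A point in more than [m + 1] members gives an injective [(m + 2)]-tuple of members all containing
   it. *)
pose s : {ffun 'I_m.+2 -> 'I_n} := [ffun l => enum_val (widen_ord mV l)].
have [||l] := Vs s _ _ z Kz.
- by rewrite mem_enum.
- by move=> a b; rewrite !ffunE => /enum_val_inj/(congr1 val) ab; apply:
    val_inj.
apply; have := enum_valP (widen_ord mV l); rewrite ffunE inE => Vz.
exact/asboolP.
Qed.

(** * From the extension property to the dimension of the corona *)

Section ExtensionDimension.
Context (R : realType) (X : metricType R) (x0 : X) (hX : topologicalType).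
Context (i : X -> hX) (m : nat).
Hypothesis hi : higson_sublinear_compactification x0 i.
Hypothesis prX : proper_space X.

(** Represents [R^(m+2)] modulo its diagonal by vectors whose last coordinate is 0, so that only
    differences of coordinates matter. *)
Let pad (v : 'rV[R]_m.+1) (l : 'I_m.+2) : R :=
  if unlift ord_max l is Some j then v 0 j else 0.

Let padZ c v l : pad (c *: v) l = c * pad v l.
Proof. by rewrite /pad; case: unlift => [j|]; rewrite ?mxE ?mulr0. Qed.

Let pad_le v l : `|pad v l| <= eucl_norm v.
Proof.
rewrite /pad; case: unlift => [j|]; first exact: coord_le_eucl_norm.
by rewrite normr0 eucl_norm_ge0.
Qed.

(* Differences of cover functions define a map into [R^(m+1)] that vanishes
   where all functions agree. Its direction away from there extends, without
   zeros, to [g]. Near the corona the [m+2] padded coordinates of [g / |x|] are thus never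
   all nearly equal, and a coordinate exceeds another one by [th] only where the
   corresponding cover function is positive. *)
Lemma extension_shrinking (W : 'I_m.+2 -> set hX) :
  extension_property x0 m ->
  (forall l, open (W l)) -> ~` range i `<=` \bigcup_l W l ->
  exists W' : 'I_m.+2 -> set hX, [/\ forall l, open (W' l),
    ~` range i `<=` \bigcup_l W' l,
    forall l z, (~` range i) z -> W' l z -> W l z &
    forall z, (~` range i) z -> exists l, ~ W' l z].
Proof.
set K := ~` range i => ext oW KW.
have cT : compact [set: hX] by case: hi => -[].
have hT : hausdorff_space hX by case: hi => -[].
have clK : closed K by exact: (closed_corona hi).
have [p [cp p01 pK pcov]] := @cover_functions R hX K _ W cT hT clK oW KW.
have k0 : 0 < m.+1%:R :> R by rewrite ltr0n.
have k1 : 1 <= m.+1%:R :> R by rewrite ler1n.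
(* Coordinates of size at most [3 * th * w] force a norm of at most [3/4 * w], which norm
   preservation excludes far out. *)
pose th : R := (4 * m.+1%:R)^-1.
have th0 : 0 < th by rewrite invr_gt0 mulr_gt0.
have th4 : th <= 4^-1 by rewrite lef_pV2 ?posrE ?mulr_gt0// ler_peMr.
(* A difference of coordinates of [g] will be at most [40 * eta * w], and [gam] adds an error of at
   most [eta * w]; together they reach exactly [th * w]. *)
pose eta := th / 41; have eta0 : 0 < eta by rewrite divr_gt0.
have [u [D [alu uD]]] := al_family_approx hi eta0 cp p01.
pose w := wt x0; have w0 x : 0 < w x by exact: wt_gt0.
pose H x : 'rV[R]_m.+1 := \row_j (u (lift ord_max j) x - u ord_max x).
have padH x l : pad (H x) l = u l x - u ord_max x.
  by rewrite /pad; case: unliftP => [j ->|->]; rewrite ?mxE ?subrr.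
have alH E j : al E (fun x => H x 0 j).
  apply: (@al_ext _ _ _ (fun x => u (lift ord_max j) x - u ord_max x)).
    by move=> x _; rewrite mxE.
  by apply: al_sub_fun; exact: al_sub (alu _).
pose A x := 8^-1 * w x <= eucl_norm (H x).
have HA x : A x -> 0 < eucl_norm (H x).
  by apply: lt_le_trans; rewrite mulr_gt0// invr_gt0.
pose f x := (ptnorm x0 x / eucl_norm (H x)) *: H x.
have npf : norm_preserving_on x0 A f.
  move=> x Ax;
    rewrite eucl_normZ ger0_norm ?divr_ge0 ?ptnorm_ge0 ?eucl_norm_ge0//.
  by rewrite divfK// gt_eqF// HA.
have xH x : A x -> ptnorm x0 x <= 8 * eucl_norm (H x).
  by move=> Ax; have := ptnorm_le_wt x0 x; move: Ax; rewrite /A /w; lra.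
have alf : asymp_lipschitz_on A f.
  apply/asymp_lipschitz_onP => j.
  apply: (@al_ext _ _ _ (fun x => ptnorm x0 x * H x 0 j / eucl_norm (H x))).
    by move=> x _; rewrite /f [RHS]mxE mulrAC.
  apply: (@al_ratio _ _ _ _ _ _ 8) => //.
  - exact: al_ptnorm.
  - exact: al_eucl_norm.
  - move=> x Ax; rewrite (le_trans (coord_le_eucl_norm _ j))//.
    by have := HA x Ax; lra.
  - by move=> x Ax; rewrite ger0_norm ?ptnorm_ge0// xH.
have [g [gf npg /asymp_lipschitz_onP alg]] := ext A f npf alf.
have [Gam [C [cGam gC]]] := al_family_extends hi alg.
pose gam l z := if unlift ord_max l is Some j then Gam j z else 0.
have cgam l : continuous (gam l).
  by rewrite /gam; case: unlift => [j //|]; exact: cst_continuous.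
have gamC l x : `|pad (g x) l - w x * gam l (i x)| <= `|C|.
  rewrite /pad /gam; case: unlift => [j|]; last by rewrite mulr0 subrr normr0.
  by rewrite (le_trans (gC j x I))// ler_norm.
have cdiff l b : continuous (fun z => gam l z - gam b z).
  by move=> z; apply: continuousB; exact: cgam.
pose W' l := \bigcup_b [set z | th < gam l z - gam b z].
exists W'; split.
- move=> l; apply: bigcup_open => b _; rewrite openE => z /= h; exact:
    near_gt (cdiff l b) h.
- move=> z Kz; apply: contrapT => nW.
  (* If [z] lies in no [W' l], all differences of the [gam] are at most [th]; comparison with the
     zero last coordinate bounds each [Gam j]. *)
  have gth j : `|Gam j z - 0| < 2 * th.
    have gamj : gam (lift ord_max j) z = Gam j z by rewrite /gam liftK.
    have gamm : gam ord_max z = 0 by rewrite /gam unlift_none.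
    rewrite subr0 -gamj (@le_lt_trans _ _ th)//; last by lra.
    rewrite leNgt; apply/negP; rewrite ltNge ler_norml => /negP; apply.
    apply/andP; split; rewrite leNgt; apply/negP => h; apply: nW.
      by exists ord_max => //; exists (lift ord_max j) => //=; rewrite gamm;
        lra.
    by exists (lift ord_max j) => //; exists ord_max => //=; rewrite gamm; lra.
  have nz : \forall z' \near z, forall j, `|Gam j z' - 0| < 2 * th.
    by apply: filter_forall => j; exact: near_dist_lt.
  have farx : far x0 [set x | `|C| / th <= w x /\ w x = ptnorm x0 x].
    by near=> x; split; near: x; [exact: far_ge_wt|exact: far_wt].
  have [x [Cx wx] gx] := far_near_corona hi.1 Kz nz farx prX.
  have : eucl_norm (g x) <= m.+1%:R * (3 * th * w x).
    apply: eucl_norm_le => j; have := gC j x I; have := gx j; have :=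
      ler_norm C.
    move: Cx; rewrite ler_pdivrMr// subr0 ltr_norml -/(w x) =>
      Cx CC /andP[g1 g2].
    rewrite ler_distl ler_norml => /andP[g3 g4].
    move: g1 g2; rewrite -(ltr_pM2l (w0 x)) => g1; rewrite -(ltr_pM2l (w0 x)) =>
      g2.
    by apply/andP; split; lra.
  rewrite npg// -wx; have -> : m.+1%:R * (3 * th * w x) = 3 / 4 * w x.
    by rewrite /th; field; rewrite gt_eqF.
  by have := w0 x; lra.
- move=> l z Kz [b _ /= lb]; apply: contrapT => nWl.
  have [a pa] := pcov z Kz.
  have pl : p l z < eta by rewrite pK.
  have nz : \forall z' \near z, [/\ th < gam l z' - gam b z',
    p l z' < eta & 2^-1 < p a z'].
    near=> z'; split; near: z'.
    + exact: near_gt (cdiff l b) lb.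
    + exact: near_lt.
    + exact: near_gt.
  have farx : far x0 [set x | D / eta <= w x /\ 2 * `|C| / eta <= w x].
    by near=> x; split; near: x; exact: far_ge_wt.
  have [x [Dx Cx] [lbx plx pax]] := far_near_corona hi.1 Kz nz farx prX.
  have {}Dx : D <= eta * w x by move: Dx; rewrite ler_pdivrMr// [leRHS]mulrC.
  have {}Cx : 2 * `|C| <= eta * w x by move: Cx; rewrite ler_pdivrMr//
    [leRHS]mulrC.
  have ul : u l x <= 3 * eta * w x.
    have := uD l x; rewrite ler_distl -/(w x) => /andP[_ ?].
    by move: plx; rewrite -(ltr_pM2l (w0 x)); lra.
  have ua : (2^-1 - 2 * eta) * w x <= u a x.
    have := uD a x; rewrite ler_distl -/(w x) => /andP[? _].
    by move: pax; rewrite -(ltr_pM2l (w0 x)); lra.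
  have ub : - (2 * eta * w x) <= u b x.
    have := uD b x; rewrite ler_distl -/(w x) => /andP[? _].
    have : 0 <= w x * p b (i x) by rewrite mulr_ge0 ?(ltW (w0 x))//; case/andP:
      (p01 b (i x)).
    by lra.
  (* [u a] is about [w / 2] or more while [u l] is nearly 0 or negative, so the padded coordinates
     of [H x] at [a] and [l] cannot both be small. *)
  have Ax : A x.
    have := pad_le (H x) a; have := pad_le (H x) l; rewrite !padH !ler_norml.
    move=> /andP[? ?] /andP[? ?]; rewrite /A.
    have : eta * w x <= 164^-1 * w x by rewrite ler_pM2r// /eta; lra.
    by lra.
  have HAx := HA x Ax.
  (* On [A], [g] is a multiple of [H] by a factor of at most 8, and [u l] exceeds [u b] by at most
     [5 * eta * w]. *)
  have : pad (g x) l - pad (g x) b <= 40 * eta * w x.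
    rewrite gf// /f !padZ !padH -mulrBr.
    have c8 : ptnorm x0 x / eucl_norm (H x) <= 8 by rewrite ler_pdivrMr// xH.
    have c0 : 0 <= ptnorm x0 x / eucl_norm (H x).
      by rewrite divr_ge0 ?ptnorm_ge0// ltW.
    have e5 :
      u l x - u ord_max x - (u b x - u ord_max x) <= 5 * eta * w x by lra.
    apply: le_trans (ler_wpM2l c0 e5) _.
    have -> : 40 * eta * w x = 8 * (5 * eta * w x) by ring.
    by rewrite ler_wpM2r// !mulr_ge0// ltW.
  have := gamC l x; have := gamC b x; rewrite !ler_distl =>
    /andP[? ?] /andP[? ?].
  have -> : eta = th / 41 by [].
  move: lbx; rewrite -(ltr_pM2l (w0 x)) => lbx h.
  have : w x * th = 41 * eta * w x by rewrite /eta; field.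
  by lra.
(* An index minimizing [gam] at [z] exceeds no other coordinate, so [z] is not in its [W' l]. *)
- move=> z Kz; pose l := [arg min_(l < (ord0 : 'I_m.+2)) gam l z]%O.
  exists l => -[b _ /=]; rewrite /l; case: arg_minP => // l' _ /(_ b isT) lb.
  by lra.
Unshelve. all: by end_near. Qed.

Lemma extension_dim_le :
  extension_property x0 m -> covering_dim_le (corona i) m.
Proof.
move=> ext; apply: order_of_shrinkings => W oW KW.
exact: extension_shrinking.
Qed.

End ExtensionDimension.

(* The sublinear Higson compactification is determined by its characterization
   up to homeomorphism over [X], so the claim is made for every model [i] of it.
   The equivalence for all [m] says that the two least integers agree, and that
   the dimension is infinite exactly when no [m] has the extension property. *)
Theorem corollary5p2 (R : realType) (X : metricType R) (x0 : X)
    (hX : topologicalType) (i : X -> hX) (m : nat) :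
  proper_space X ->
  higson_sublinear_compactification x0 i ->
  covering_dim (corona i) m <-> least (extension_property x0) m.
Proof.
move=> prX hi.
have E k : covering_dim_le (corona i) k <-> extension_property x0 k.
  by split; [exact: dim_le_extension|exact: extension_dim_le].
by split=> -[/E Pm least_m]; split=> // k /E; exact: least_m.
Qed.
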